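(* Let $n\ge 1$, and assume that $p=0$ or $p>n$, and that $\delta\neq 0$ if $n$ is even. Let $\omega=(\omega_0,\ldots,\omega_{m-1})$ be an $m$-composition of $n$ and let $B^m_\omega=\pi_\omega B^m_n(\delta)\pi_\omega$. Then $B^m_\omega$ is isomorphic to a product of Brauer and walled Brauer algebras with parameters $\overline{\delta}_r$ for $0\le r\le\lfloor m/2\rfloor$. More specifically, $$B^m_\omega\cong B(\omega_0,\overline{\delta}_0)\otimes\bigotimes_{r=1}^{\lfloor m/2\rfloor}WB(\omega_r,\omega_{m-r},\overline{\delta}_r)$$ if $m$ is odd, and $$B^m_\omega\cong B(\omega_0,\overline{\delta}_0)\otimes\left(\bigotimes_{r=1}^{(m/2)-1}WB(\omega_r,\omega_{m-r},\overline{\delta}_r)\right)\otimes B(\omega_{m/2},\overline{\delta}_{m/2})$$ if $m$ is even.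
   Context: $k$ is an algebraically closed field of characteristic $p\ge 0$, $m\ge 1$ is an integer invertible in $k$, $\xi\in k$ is a fixed primitive $m$-th root of unity, and $\delta=(\delta_0,\ldots,\delta_{m-1})\in k^m$. Cyclotomic Brauer algebra $B_n^m=B_n^m(\delta)$. A reduced $(m,n)$-diagram is a perfect matching of $n$ northern nodes $1,\ldots,n$ and $n$ southern nodes $\bar1,\ldots,\bar n$ (numbered left to right), each strand being oriented and labelled by an element of $\mathbb Z/m\mathbb Z$; reversing the orientation of a strand replaces its label by the negative, and diagrams equal up to such changes are identified. Strands joining a northern to a southern node are through strands, the others are arcs. $B_n^m$ has $k$-basis the reduced $(m,n)$-diagrams. The product $x\cdot y$ is obtained by placing $x$ above $y$, identifying southern nodes of $x$ with northern nodes of $y$, choosing compatible orientations, and adding labels along each new strand; each closed loop is oriented so that it points downwards at its leftmost central node, and if its total label is then $i$ it is removed and replaced by the scalar $\delta_i$. $B_0^m=k$. $t_i^q$ denotes the diagram with through strands $l\to\bar l$ for all $l$, the strand at $i$ (oriented downwards) labelled $q$ and all others labelled $0$. $T_i^r=\frac1m\sum_{q=1}^{m}\xi^{qr}t_i^q$ for $1\le i\le n$, $0\le r\le m-1$. An $m$-composition of $n$ is a tuple $\omega=(\omega_0,\ldots,\omega_{m-1})$ of non-negative integers with sum $n$. Put $[\omega_r]=\sum_{i=0}^r\omega_i$, $[\omega_{-1}]=0$, and write $i\in[\omega_r]$ if $[\omega_{r-1}]<i\le[\omega_r]$. Define the idempotent $\pi_\omega=\prod_{r=0}^{m-1}\prod_{i\in[\omega_r]}T_i^r$.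 $\overline{\delta}_r=\frac1m\sum_{i=0}^{m-1}\xi^{ir}\delta_i$. $B(a,d)$ ($a\ge 0$, $d\in k$) is the classical Brauer algebra on $a$ strands with loop parameter $d$ (with $B(0,d)=k$). $WB(a,b,d)$ is the walled Brauer algebra: the subalgebra of $B(a+b,d)$ spanned by the Brauer diagrams in which, with a wall placed after the first $a$ northern and southern nodes, every arc crosses the wall and no through strand crosses it. *)

(* Defs.v *)
From mathcomp Require Import all_boot all_order all_algebra.

Set Implicit Arguments.
Unset Strict Implicit.
Unset Printing Implicit Defensive.

Import GRing.Theory.
Local Open Scope ring_scope.

(** * Algebras given by a finite basis and structure constants *)

(* [sc_mul x y] is the product of two basis elements, [sc_one] the unit, both
   written in the basis.  Associativity and unitality are not part of the
   record: for arbitrary loop parameters delta the product of the cyclotomic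
   Brauer algebra is not associative (see [cyclotomic_brauer]). *)
Record based_algebra (k : fieldType) := BasedAlgebra {
  basis : finType;
  sc_mul : basis -> basis -> {ffun basis -> k^o};
  sc_one : {ffun basis -> k^o}
}.

Definition elt (k : fieldType) (A : based_algebra k) := {ffun basis A -> k^o}.

Definition basis_vec (k : fieldType) (X : finType) (x : X) : {ffun X -> k^o} :=
  [ffun z => (z == x)%:R].

Definition amul (k : fieldType) (A : based_algebra k) (x y : elt A) : elt A :=
  \sum_a \sum_b (x a * y b) *: sc_mul a b.

Definition aone (k : fieldType) (A : based_algebra k) : elt A := sc_one A.

(* The subalgebra spanned by the basis elements satisfying [P]. *)
Definition span_subalgebra (k : fieldType) (A : based_algebra k)
    (P : pred (basis A))
    (_ : forall x y z, P x -> P y -> sc_mul x y z != 0 -> P z)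
    (_ : forall z, sc_one A z != 0 -> P z) : based_algebra k :=
  @BasedAlgebra k {x : basis A | P x}
    (fun x y => [ffun z => sc_mul (val x) (val y) (val z)])
    [ffun z => sc_one A (val z)].

Definition ground_algebra (k : fieldType) : based_algebra k :=
  @BasedAlgebra k unit (fun _ _ => [ffun=> 1]) [ffun=> 1].

(* The basis vector indexed by the pair (x, y) is x \otimes y, and
   (x \otimes y)(x' \otimes y') = x x' \otimes y y'. *)
Definition tensor_algebra (k : fieldType) (A B : based_algebra k) :
    based_algebra k :=
  @BasedAlgebra k (basis A * basis B)%type
    (fun u v => [ffun w => sc_mul u.1 v.1 w.1 * sc_mul u.2 v.2 w.2])
    [ffun w => sc_one A w.1 * sc_one B w.2].

Definition corner (k : fieldType) (A : based_algebra k) (e z : elt A) : Prop :=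
  exists x : elt A, z = amul (amul e x) e.

(* e A e, with unit e, is isomorphic to C: a multiplicative, unital, injective
   linear map from C to A with image e A e. *)
Definition corner_isomorphic (k : fieldType) (A : based_algebra k) (e : elt A)
    (C : based_algebra k) : Prop :=
  exists phi : {linear elt C -> elt A},
    [/\ injective phi,
        forall z : elt A, corner e z <-> exists x : elt C, phi x = z,
        forall x y : elt C, phi (amul x y) = amul (phi x) (phi y)
      & phi (aone C) = e].

(** * Reduced (m, n)-diagrams *)

(* Z/mZ for m >= 1; note that 'Z_1 would be Z/2Z. *)
Definition label (m : nat) := 'I_m.-1.+1.

(* [inl i] is the northern node i, [inr i] the southern node i; nodes are
   numbered from 0. *)
Definition node (n : nat) := ('I_n + 'I_n)%type.

Definition node_pos (n : nat) (u : node n) : nat :=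
  match u with inl i => i | inr i => i end.

Definition northern (n : nat) (u : node n) : bool :=
  if u is inl _ then true else false.

(* [f u = (v, c)] means: the strand at u joins u to v, and its label is c when
   it is oriented from u to v.  Recording both orientations of every strand
   makes equal the diagrams that differ by a change of orientation. *)
Definition is_diagram (m n : nat) (f : {ffun node n -> node n * label m}) :=
  [forall u, ((f u).1 != u) && (f (f u).1 == (u, - (f u).2))].

Definition diagram (m n : nat) :=
  {f : {ffun node n -> node n * label m} | is_diagram f}.

(** * Concatenation: x on top of y *)

(* The dart (b, u) is the strand at the node u of x (b = true) or of y
   (b = false), oriented away from u. *)
Definition dart (n : nat) := (bool * node n)%type.

Definition central (n : nat) (d : dart n) : bool := d.1 (+) northern d.2.

(* The southern node i of x is identified with the northern node i of y. *)
Definition glue (n : nat) (d : dart n) : dart n :=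
  match d with
  | (true, inr i) => (false, inl i)
  | (false, inl i) => (true, inr i)
  | _ => d
  end.

Definition dart_strand (m n : nat) (x y : diagram m n) (d : dart n) :=
  val (if d.1 then x else y) d.2.

Definition dart_end (m n : nat) (x y : diagram m n) (d : dart n) : dart n :=
  (d.1, (dart_strand x y d).1).

Definition dart_label (m n : nat) (x y : diagram m n) (d : dart n) : label m :=
  (dart_strand x y d).2.

(* Follow a strand to its end, and enter the other diagram if this end is a
   central node. *)
Definition walk (m n : nat) (x y : diagram m n) (d : dart n) : dart n :=
  glue (dart_end x y d).

(* The least i >= 1 such that the i-th step of the walk reaches a node which is
   not central. *)
Definition walk_length (m n : nat) (x y : diagram m n) (d : dart n) : nat :=
  (find (fun i => ~~ central (iter i.+1 (walk x y) d)) (iota 0 #|{: dart n}|)).+1.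

Definition outer_dart (n : nat) (u : node n) : dart n := (northern u, u).

Definition concat_fun (m n : nat) (x y : diagram m n) :
    {ffun node n -> node n * label m} :=
  [ffun u => let d := outer_dart u in let l := walk_length x y d in
    ((iter l (walk x y) d).2, \sum_(i < l) dart_label x y (iter i (walk x y) d))].

Lemma glueK n : involutive (@glue n).
Proof. by case=> [[] []]. Qed.

Lemma central_glue n (d : dart n) : central (glue d) = central d.
Proof. by case: d => [[] []]. Qed.

Lemma glue_outer n (d : dart n) : ~~ central d -> glue d = d.
Proof. by case: d => [[] []]. Qed.

Lemma glue_central n (d : dart n) : central d -> glue d != d.
Proof. by case: d => [[] []]. Qed.

Lemma outer_outer_dart n (u : node n) : ~~ central (outer_dart u).
Proof. by rewrite /central addbb. Qed.

Lemma outer_dartK n (d : dart n) : ~~ central d -> outer_dart d.2 = d.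
Proof. by case: d => [[] []]. Qed.

Lemma diagram_neq m n (x : diagram m n) u : (val x u).1 != u.
Proof. by have /forallP/(_ u)/andP[] := valP x. Qed.

Lemma diagramK m n (x : diagram m n) u :
  val x (val x u).1 = (u, - (val x u).2).
Proof. by have /forallP/(_ u)/andP[_ /eqP] := valP x. Qed.

Lemma dart_endK m n (x y : diagram m n) : involutive (dart_end x y).
Proof. by case=> b u; rewrite /dart_end /dart_strand /= diagramK. Qed.

Lemma dart_end_neq m n (x y : diagram m n) d : dart_end x y d != d.
Proof.
by case: d => b u; rewrite /dart_end /dart_strand xpair_eqE eqxx diagram_neq.
Qed.

Lemma dart_label_end m n (x y : diagram m n) d :
  dart_label x y (dart_end x y d) = - dart_label x y d.
Proof. by case: d => b u; rewrite /dart_label /dart_strand /= diagramK. Qed.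

Lemma walk_inj m n (x y : diagram m n) : injective (walk x y).
Proof.
exact: inj_comp (can_inj (@glueK n)) (can_inj (dart_endK x y)).
Qed.

Lemma walk_lengthP m n (x y : diagram m n) d : ~~ central d ->
  ~~ central (iter (walk_length x y d) (walk x y) d) /\
  forall i, (0 < i < walk_length x y d)%N -> central (iter i (walk x y) d).
Proof.
move=> dout; rewrite /walk_length; set p := (p in find p _).
have hp : has p (iota 0 #|{: dart n}|).
  apply/hasP; exists (fingraph.order (walk x y) d).-1; last first.
    by rewrite /p orderSpred iter_order //; apply: walk_inj.
  by rewrite mem_iota add0n /= orderSpred max_card.
split.
  have := nth_find 0%N hp; rewrite nth_iota ?add0n //.
  by rewrite -[X in (_ < X)%N](size_iota 0) -has_find.
case=> [//|i] /= lt_i; have := @before_find _ 0%N p (iota 0 #|{: dart n}|) i lt_i.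
rewrite nth_iota ?add0n; first by move/negbFE.
rewrite -[X in (_ < X)%N](size_iota 0).
by apply: leq_trans (find_size p _); rewrite -ltnS.
Qed.

Lemma walk_length_unique m n (x y : diagram m n) d l : ~~ central d ->
  (0 < l)%N -> ~~ central (iter l (walk x y) d) ->
  (forall i, (0 < i < l)%N -> central (iter i (walk x y) d)) ->
  walk_length x y d = l.
Proof.
move=> dout l0 lout lcen; have [wout wcen] := walk_lengthP x y dout.
case: (ltngtP (walk_length x y d) l) => // lt_l.
  by move: wout; rewrite lcen.
by move: lout; rewrite wcen // l0.
Qed.

Lemma iter_walk_rev m n (x y : diagram m n) d l i : (i <= l)%N ->
  let v := iter l (walk x y) d in ~~ central v ->
  iter i (walk x y) v = glue (iter (l - i) (walk x y) d).
Proof.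
move=> + v vout; elim: i => [_|i IHi lt_il]; first by rewrite subn0 glue_outer.
rewrite iterS IHi ?(ltnW lt_il) // -(subnSK lt_il) iterS.
by rewrite /walk glueK dart_endK.
Qed.

Lemma walk_length_rev m n (x y : diagram m n) d : ~~ central d ->
  walk_length x y (iter (walk_length x y d) (walk x y) d) = walk_length x y d.
Proof.
move=> dout; have [wout wcen] := walk_lengthP x y dout.
apply: walk_length_unique => // [|i /andP[i0 lt_i]].
  by rewrite iter_walk_rev // subnn central_glue.
rewrite iter_walk_rev ?(ltnW lt_i) // central_glue wcen //.
by rewrite subn_gt0 lt_i ltn_subrL i0.
Qed.

Lemma concat_is_diagram m n (x y : diagram m n) : is_diagram (concat_fun x y).
Proof.
apply/forallP=> u; rewrite !ffunE; cbn [fst snd].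
have dout := outer_outer_dart u; set d := outer_dart u in dout *.
have [wout wcen] := walk_lengthP x y dout.
have lrev := walk_length_rev x y dout.
have l0 : (0 < walk_length x y d)%N by [].
move: wout wcen lrev l0; move: (walk_length x y d) => l wout wcen lrev l0.
rewrite outer_dartK // lrev iter_walk_rev // subnn glue_outer //.
rewrite xpair_eqE eqxx /=; apply/andP; split; last first.
  rewrite -sumrN (reindex_inj rev_ord_inj) /=; apply/eqP/eq_bigr => i _.
  rewrite iter_walk_rev // ?leq_subr // subKn // iterS.
  by rewrite /walk glueK dart_label_end.
apply/eqP=> eq_du.
have eq_d : iter l (walk x y) d = d by rewrite -(outer_dartK wout) eq_du.
have rev i : (i <= l)%N ->
    iter i (walk x y) d = glue (iter (l - i) (walk x y) d).
  by move=> le_il; rewrite -iter_walk_rev // eq_d.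
have := odd_double_half l; case: (odd l) => /= El.
  have := rev l./2.+1; rewrite -[X in (_ < X)%N]El -[X in (X - _)%N]El.
  rewrite add1n ltnS -addnn leq_addl subSS addnK iterS => /(_ isT).
  by move/(can_inj (@glueK n))/eqP; rewrite (negPf (dart_end_neq x y _)).
have h0 : (0 < l./2)%N by rewrite -double_gt0 -[_.*2]add0n El.
have := rev l./2; rewrite -[X in (_ <= X)%N]El -[X in (X - _)%N]El add0n -addnn.
rewrite leq_addl addnK => /(_ isT) /esym /eqP; apply/negP/glue_central/wcen.
by rewrite h0 -[X in (_ < X)%N]El add0n -addnn -{1}(add0n l./2) ltn_add2r.
Qed.

Definition concat (m n : nat) (x y : diagram m n) : diagram m n :=
  exist _ (concat_fun x y) (concat_is_diagram x y).

(* The central node j lies on a closed loop, of which it is the leftmost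
   central node.  The dart (false, inl j) points downwards from j. *)
Definition loop_at (m n : nat) (x y : diagram m n) (j : 'I_n) : bool :=
  all (fun d => central d && (j <= node_pos d.2)%N)
    (orbit (walk x y) (false, inl j)).

Definition loop_label (m n : nat) (x y : diagram m n) (j : 'I_n) : label m :=
  \sum_(d <- orbit (walk x y) (false, inl j)) dart_label x y d.

Definition loop_scalar (k : fieldType) (m n : nat) (delta : m.-tuple k)
    (x y : diagram m n) : k :=
  \prod_(j < n | loop_at x y j) delta`_(loop_label x y j).

(** * Cyclotomic Brauer, Brauer and walled Brauer algebras *)

Definition twist_fun (m n : nat) (i : 'I_n) (q : label m) :
    {ffun node n -> node n * label m} :=
  [ffun u => match u with
             | inl l => (inr l, if l == i then q else 0)
             | inr l => (inl l, if l == i then - q else 0)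
             end].

Lemma twist_is_diagram m n (i : 'I_n) (q : label m) :
  is_diagram (twist_fun i q).
Proof.
by apply/forallP=> -[] l; rewrite !ffunE /=; case: (l == i);
  rewrite ?oppr0 ?opprK eqxx.
Qed.

(* t_i^q *)
Definition twist (m n : nat) (i : 'I_n) (q : label m) : diagram m n :=
  exist _ (twist_fun i q) (twist_is_diagram i q).

Definition id_fun (m n : nat) : {ffun node n -> node n * label m} :=
  [ffun u => (match u with inl l => inr l | inr l => inl l end, 0)].

Lemma id_is_diagram m n : is_diagram (id_fun m n).
Proof. by apply/forallP=> -[] l; rewrite !ffunE /= oppr0 eqxx. Qed.

Definition id_diagram (m n : nat) : diagram m n :=
  exist _ (id_fun m n) (id_is_diagram m n).

(* With the loop convention used here, the product is associative only if
   delta_i = delta_(-i), since e_1 t_1^i e_1 = e_1 t_2^(-i) e_1, where e_1 s_1 =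
   e_1 and s_1 exchanges t_1 and t_2.  No such assumption is made. *)
Definition cyclotomic_brauer (k : fieldType) (m n : nat) (delta : m.-tuple k) :
    based_algebra k :=
  @BasedAlgebra k (diagram m n)
    (fun x y => loop_scalar delta x y *: basis_vec k (concat x y))
    (basis_vec k (id_diagram m n)).

(* For m = 1 all labels are 0 and every closed loop is replaced by d. *)
Definition brauer (k : fieldType) (a : nat) (d : k) : based_algebra k :=
  cyclotomic_brauer a [tuple d].

Definition left_of_wall (a n : nat) (u : node n) : bool := (node_pos u < a)%N.

(* Arcs cross the wall, through strands do not. *)
Definition walled (a b : nat) (x : diagram 1 (a + b)) : bool :=
  [forall u, let v := (val x u).1 in
    if northern u == northern v then left_of_wall a u != left_of_wall a v
    else left_of_wall a u == left_of_wall a v].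

Lemma walledP a b (x : diagram 1 (a + b)) :
  reflect (forall u, northern (val x u).1 (+) left_of_wall a (val x u).1 =
                     ~~ (northern u (+) left_of_wall a u))
          (walled x).
Proof.
by apply: (iffP forallP) => H u; have := H u; cbv beta zeta;
  case: (northern u); case: (northern (val x u).1);
  case: (left_of_wall a u); case: (left_of_wall a (val x u).1).
Qed.

Lemma walled_concat a b (x y : diagram 1 (a + b)) :
  walled x -> walled y -> walled (concat x y).
Proof.
move=> /walledP wx /walledP wy; apply/walledP=> u.
rewrite [val _]/(concat_fun x y) ffunE; cbn [fst snd].
have [] := walk_lengthP x y (outer_outer_dart u).
have : (0 < walk_length x y (outer_dart u))%N by [].
case: (walk_length x y (outer_dart u)) => // l _ wout wcen.
pose s (d : dart (a + b)) := northern d.2 (+) left_of_wall a d.2.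
have s_end d : s (dart_end x y d) = ~~ s d.
  by case: d => -[] v; [apply: wx | apply: wy].
have s_glue d : central d -> s (glue d) = ~~ s d.
  by case: d => -[] [] v; rewrite //= /s /= ?negbK.
have s_iter i : (i <= l)%N -> s (iter i (walk x y) (outer_dart u)) =
                               s (outer_dart u).
  elim: i => // i IHi lt_il; have := wcen i.+1; rewrite !ltnS lt_il => /(_ isT).
  rewrite -IHi ?(ltnW lt_il) // iterS; move: (iter i _ _) => e.
  by rewrite /walk central_glue => /s_glue->; rewrite s_end negbK.
change (s (iter l.+1 (walk x y) (outer_dart u)) = ~~ s (outer_dart u)).
rewrite -(s_iter l) // -s_end iterS; congr (s _).
by apply: glue_outer; rewrite -central_glue.
Qed.

Lemma walled_mul_closed (k : fieldType) a b (d : k)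
    (x y z : basis (brauer (a + b) d)) :
  walled x -> walled y -> sc_mul x y z != 0 -> walled z.
Proof.
move=> wx wy; rewrite !ffunE; have [-> _|_] := eqVneq z (concat x y).
  exact: walled_concat.
by rewrite scaler0 eqxx.
Qed.

Lemma walled_one_closed (k : fieldType) a b (d : k)
    (z : basis (brauer (a + b) d)) : sc_one (brauer (a + b) d) z != 0 -> walled z.
Proof.
rewrite ffunE; have [-> _|_] := eqVneq z (id_diagram 1 (a + b)); 
  last by rewrite eqxx.
by apply/walledP=> -[] l; rewrite ffunE //= negbK.
Qed.

Definition walled_brauer (k : fieldType) (a b : nat) (d : k) : based_algebra k :=
  span_subalgebra (@walled_mul_closed k a b d) (@walled_one_closed k a b d).

(** * The idempotents pi_omega *)

Definition Tidem (k : fieldType) (m n : nat) (delta : m.-tuple k) (xi : k)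
    (i : 'I_n) (r : nat) : elt (cyclotomic_brauer n delta) :=
  m%:R^-1 *: \sum_(1 <= q < m.+1) xi ^+ (q * r) *: basis_vec k (twist i (inZp q)).

Definition is_composition (m n : nat) (omega : m.-tuple nat) : Prop :=
  (\sum_(r < m) nth 0 omega r)%N = n.

(* Nodes are numbered from 0, so [omega_(r-1)] < i + 1 <= [omega_r]. *)
Definition in_block (m : nat) (omega : m.-tuple nat) (r i : nat) : bool :=
  (\sum_(j < r) nth 0 omega j <= i < \sum_(j < r.+1) nth 0 omega j)%N.

(* The bracketing of the product is immaterial: products of the t_i^q create
   no closed loops. *)
Definition pi_idem (k : fieldType) (m n : nat) (delta : m.-tuple k) (xi : k)
    (omega : m.-tuple nat) : elt (cyclotomic_brauer n delta) :=
  let mul := @amul k (cyclotomic_brauer n delta) in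
  let one := aone (cyclotomic_brauer n delta) in
  \big[mul/one]_(r < m) \big[mul/one]_(i < n | in_block omega r i)
    Tidem delta xi i r.

Definition delta_bar (k : fieldType) (m : nat) (delta : m.-tuple k) (xi : k)
    (r : nat) : k :=
  m%:R^-1 * \sum_(i < m) xi ^+ (i * r) * delta`_i.

Definition has_characteristic (R : nzRingType) (p : nat) : Prop :=
  if p == 0%N then [pchar R] =i pred0 else p \in [pchar R].

(* Main.v *)
(* Attach to the node i the root of unity z_i = xi^r, where r is the type of i,
   and to a diagram the product over its strands, taken from u to v with label
   c, of z_u^c, with z inverted at southern nodes.  Twisting a diagram by
   pi_omega on both sides averages over all labellings of its matching with
   this weight; the average vanishes unless the charges at the two ends of every
   strand are mutually inverse, and otherwise it depends, up to a scalar, only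
   on the matching.  The charge is constant along a walk through two stacked
   compatible diagrams, so the weight is multiplicative, and averaging the
   labels of the closed loops turns each of them into delta_bar at the type of
   its leftmost node.  A compatible matching never joins nodes of types r and s
   unless s = r or s = -r, hence it splits into a Brauer diagram for each
   self-inverse type and a walled Brauer diagram for each pair {r, -r}. *)
From HB Require Import structures.
Require Import Defs.
From mathcomp Require Import all_boot all_order all_algebra ring zify.
Import GRing.Theory.
Local Open Scope ring_scope.

Set Implicit Arguments.
Unset Strict Implicit.
Unset Printing Implicit Defensive.

(** Since the product is not associative for general [delta], nothing may be deduced from
    rebracketing: [pi_idem] and each e x e are computed on diagrams with the brackets as given. All
    labellings of a matching form one orbit of the functions from nodes to Z/m (a strand from u to v
    labelled c becomes c + q u - q v), and twisting above and below is exactly this action. The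
    obstacle is the product of two averages, where many pairs of labellings give the same product
    with the same loops. Instead of counting fibres, the double sum is averaged once more, over
    gauges of the two factors that add a prescribed gauge to the product and, independently, a
    prescribed label to each closed loop. This decouples the loop labels from each other and from
    the product, and the loop values factor out. Multiplicativity of the weight needs every strand
    of the factors to be used exactly once, in one direction, by the strands and loops of the
    product; hence the study of darts and orientations. *)

(** * Comparing diagrams through their matchings *)

Definition node_map (a n : nat) (f : 'I_a -> 'I_n) (u : node a) : node n :=
  match u with inl i => inl (f i) | inr i => inr (f i) end.

Definition dart_map (a n : nat) (f : 'I_a -> 'I_n) (d : dart a) : dart n :=
  (d.1, node_map f d.2).

(** Only partners are compared, since the labels may lie in different groups: this covers both
    relabelling a diagram ([f] the identity) and restricting it to an unlabelled diagram on some of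
    its nodes. *)
Definition embeds (a n m m' : nat) (f : 'I_a -> 'I_n)
    (x : diagram m n) (x' : diagram m' a) :=
  forall u, (val x (node_map f u)).1 = node_map f (val x' u).1.

Lemma node_map_inj a n (f : 'I_a -> 'I_n) :
  injective f -> injective (node_map f).
Proof. by move=> fI [] i [] j //= [] /fI->. Qed.

Lemma node_map_id n (u : node n) : node_map id u = u.
Proof. by case: u. Qed.

Lemma dart_map_id n (d : dart n) : dart_map id d = d.
Proof. by case: d => b u; rewrite /dart_map node_map_id. Qed.

Lemma central_dart_map a n (f : 'I_a -> 'I_n) d :
  central (dart_map f d) = central d.
Proof. by case: d => [[] []]. Qed.

Lemma outer_dart_map a n (f : 'I_a -> 'I_n) u :
  outer_dart (node_map f u) = dart_map f (outer_dart u).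
Proof. by case: u. Qed.

Lemma node_pos_map a n (f : 'I_a -> 'I_n) (d : dart a) (i : 'I_a) :
  (forall i j, (f i <= f j) = (i <= j))%N ->
  (f i <= node_pos (dart_map f d).2)%N = (i <= node_pos d.2)%N.
Proof. by case: d => b [] j fmono; rewrite /= fmono. Qed.

Lemma loop_atP m n (x y : diagram m n) (j : 'I_n) :
  reflect (forall i, let d := iter i (walk x y) (false, inl j) in
                     central d /\ (j <= node_pos d.2)%N)
          (loop_at x y j).
Proof.
apply: (iffP allP) => [H i d|H d].
  by apply/andP/H; rewrite -fconnect_orbit fconnect_iter.
by rewrite -fconnect_orbit => /iter_findex <-; apply/andP/H.
Qed.

Section Embedding.

Variables (a n m m' : nat) (f : 'I_a -> 'I_n).
Variables (x y : diagram m n) (x' y' : diagram m' a).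
Hypotheses (xx' : embeds f x x') (yy' : embeds f y y').

Lemma walk_embed d : walk x y (dart_map f d) = dart_map f (walk x' y' d).
Proof.
rewrite /walk /dart_end /dart_strand; case: d => [[] u] /=; rewrite ?xx' ?yy'.
  by case: (fst (val x' u)).
by case: (fst (val y' u)).
Qed.

Lemma iter_walk_embed i d :
  iter i (walk x y) (dart_map f d) = dart_map f (iter i (walk x' y') d).
Proof. by elim: i => //= i ->; rewrite walk_embed. Qed.

Lemma walk_length_embed d : ~~ central d ->
  walk_length x y (dart_map f d) = walk_length x' y' d.
Proof.
move=> dout; have [wout wcen] := walk_lengthP x' y' dout.
apply: walk_length_unique; rewrite ?central_dart_map //.
  by rewrite iter_walk_embed central_dart_map.
by move=> i lt_i; rewrite iter_walk_embed central_dart_map wcen.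
Qed.

Lemma concat_embed : embeds f (concat x y) (concat x' y').
Proof.
move=> u; rewrite !ffunE; cbn [fst snd].
by rewrite outer_dart_map walk_length_embed ?outer_outer_dart ?iter_walk_embed.
Qed.

(** Monotonicity of [f] makes the leftmost node of a loop correspond to the leftmost node of its
    image. *)
Lemma loop_at_embed (j : 'I_a) : (forall i j, (f i <= f j) = (i <= j))%N ->
  loop_at x y (f j) = loop_at x' y' j.
Proof.
move=> fmono; apply/loop_atP/loop_atP => H i;
  move: (H i); rewrite /= -[(false, inl (f j))]/(dart_map f (false, inl j));
  by rewrite iter_walk_embed central_dart_map node_pos_map.
Qed.

End Embedding.

Definition same_shape (m n : nat) (x y : diagram m n) :=
  forall u, (val x u).1 = (val y u).1.

Lemma same_shape_embeds m n (x y : diagram m n) :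
  same_shape x y -> embeds id x y.
Proof. by move=> xy u; rewrite !node_map_id. Qed.

Section SameShape.

Variables (m n : nat) (x y x' y' : diagram m n).
Hypotheses (xx' : same_shape x x') (yy' : same_shape y y').
Let ex := same_shape_embeds xx'.
Let ey := same_shape_embeds yy'.

Lemma same_shape_walk : walk x y =1 walk x' y'.
Proof. by move=> d; have := walk_embed ex ey d; rewrite !dart_map_id. Qed.

Lemma same_shape_walk_length d : ~~ central d ->
  walk_length x y d = walk_length x' y' d.
Proof. by move=> /(walk_length_embed ex ey); rewrite dart_map_id. Qed.

Lemma same_shape_concat : same_shape (concat x y) (concat x' y').
Proof. by move=> u; have := concat_embed ex ey u; rewrite !node_map_id. Qed.

Lemma same_shape_loop_at j : loop_at x y j = loop_at x' y' j.
Proof. by apply: (loop_at_embed (f := id) ex ey). Qed.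

Lemma same_shape_orbit d : orbit (walk x y) d =i orbit (walk x' y') d.
Proof.
by move=> e; rewrite -!fconnect_orbit; apply/eq_fconnect/same_shape_walk.
Qed.

End SameShape.

Lemma iter_inj (T : Type) (f : T -> T) i : injective f -> injective (iter i f).
Proof. by move=> fI; elim: i => //= i IH u v /fI/IH. Qed.

(** * Orientations and the decomposition of the darts into strands and loops *)

Section Darts.

Variables (m n : nat) (x y : diagram m n).
Local Notation w := (walk x y).
Local Notation ed := (dart_end x y).

Lemma walk_end d : w (ed d) = glue d.
Proof. by rewrite /walk dart_endK. Qed.

Lemma glue_walk d : glue (w d) = ed d.
Proof. by rewrite /walk glueK. Qed.

(** The walk is the composite of the involutions [glue] and [ed], so [ed] conjugates it into its
    inverse. *)
Lemma iter_walk_end i d : iter i w (ed (iter i w d)) = ed d.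
Proof.
elim: i d => // i IH d.
by rewrite iterSr walk_end -{1}[iter i.+1 w d]/(w _) glue_walk IH.
Qed.

(** A closed walk cannot return along a strand it has used: the walks from the two sides would meet
    at a dart fixed by [glue] or by [ed], according to the parity of [i]. *)
Lemma end_not_reached i d : (forall j, central (iter j w d)) ->
  iter i w d <> ed d.
Proof.
move=> cen eq_id; have := odd_double_half i; case: (odd i) => /= Ei.
  have := iter_walk_end i./2 d; rewrite -eq_id -{3}Ei add1n -addnn -addnS iterD.
  move/(iter_inj (@walk_inj _ _ x y)); rewrite iterS -glue_walk -iterS.
  by apply/eqP/glue_central/(cen i./2.+1).
have := iter_walk_end i./2 d; rewrite -eq_id -{3}Ei add0n -addnn iterD.
move/(iter_inj (@walk_inj _ _ x y)); exact/eqP/dart_end_neq.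
Qed.

End Darts.

Definition first_end (m n : nat) (x : diagram m n) (u : node n) : bool :=
  (enum_rank u < enum_rank (val x u).1)%N.

Lemma first_end_partner m n (x : diagram m n) u :
  first_end x (val x u).1 = ~~ first_end x u.
Proof.
rewrite /first_end diagramK /= -leqNgt [RHS]leq_eqVlt (inj_eq (@ord_inj _)).
by rewrite (inj_eq enum_rank_inj) (negPf (diagram_neq x u)).
Qed.

(** Where [O] and [O'] disagree, [s] exchanges their darts, and [F] does not see the exchange. *)
Lemma prod_orientation (R : comPzRingType) (T : finType) (s : T -> T)
    (O O' : pred T) (F : T -> R) :
  involutive s -> (forall d, O (s d) = ~~ O d) ->
  (forall d, O' (s d) = ~~ O' d) -> (forall d, F (s d) = F d) ->
  \prod_(d | O d) F d = \prod_(d | O' d) F d.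
Proof.
move=> sK sO sO' sF; rewrite (bigID O') [RHS](bigID O) /=; congr (_ * _).
  by apply: eq_bigl => d; rewrite andbC.
rewrite (reindex_inj (can_inj sK)) /=; apply: eq_big => [d|d _]; last exact: sF.
by rewrite sO sO' negbK andbC.
Qed.

Lemma prod_bigcup_disjoint (R : comPzRingType) (I T : finType) (P : pred I)
    (B : I -> {set T}) (F : T -> R) :
  (forall i j, P i -> P j -> i != j -> [disjoint B i & B j]) ->
  \prod_(d in \bigcup_(i | P i) B i) F d = \prod_(i | P i) \prod_(d in B i) F d.
Proof.
move=> disj; under [RHS]eq_bigr => i _ do rewrite big_mkcond.
rewrite exchange_big big_mkcond; apply: eq_bigr => d _ /=.
case: bigcupP => [[i Pi di]|nd].
  rewrite (bigD1 i) //= di big1 ?mulr1 // => j /andP[Pj ne_ji].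
  by rewrite (disjointFl (disj j i Pj Pi ne_ji)).
by rewrite big1 // => i Pi; case: ifP => // di; case: nd; exists i.
Qed.

Section Decomposition.

Variables (m n : nat) (x y : diagram m n).
Local Notation w := (walk x y).
Local Notation ed := (dart_end x y).
Local Notation len u := (walk_length x y (outer_dart u)).

Definition path_darts (u : node n) : {set dart n} :=
  [set d in traject w (outer_dart u) (len u)].

Definition loop_darts (j : 'I_n) : {set dart n} :=
  [set d in orbit w (false, inl j)].

Lemma path_dartsP u d :
  reflect (exists2 i, (i < len u)%N & d = iter i w (outer_dart u))
          (d \in path_darts u).
Proof. by rewrite inE; apply: trajectP. Qed.

Lemma iter_walk_len u : iter (len u) w (outer_dart u) =
  outer_dart (val (concat x y) u).1.
Proof.
rewrite ffunE; cbn [fst]; rewrite outer_dartK //.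
by have [] := walk_lengthP x y (outer_outer_dart u).
Qed.

Lemma iter_walk_central u i : (0 < i < len u)%N ->
  central (iter i w (outer_dart u)).
Proof. by have [_] := walk_lengthP x y (outer_outer_dart u); apply. Qed.

Lemma len_partner u : len (val (concat x y) u).1 = len u.
Proof. by rewrite -iter_walk_len walk_length_rev // outer_outer_dart. Qed.

(** Cancelling the shorter walk by injectivity leaves an outer dart that would be an interior, hence
    central, dart of the other path. *)
Lemma path_start u v i i' : (i < len u)%N -> (i' < len v)%N ->
  iter i w (outer_dart u) = iter i' w (outer_dart v) -> u = v /\ i = i'.
Proof.
have sym u' v' a b : (b < len v')%N -> (a <= b)%N ->
    iter a w (outer_dart u') = iter b w (outer_dart v') -> u' = v' /\ a = b.
  move=> lt_b le_ab; rewrite -(subnKC le_ab) iterD.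
  move=> /(iter_inj (@walk_inj _ _ x y)); case E: (b - a)%N => [|c] eq_uv.
    by rewrite addn0; split=> //; have := congr1 snd eq_uv.
  have := outer_outer_dart u'; rewrite eq_uv iter_walk_central //= -E.
  exact: leq_ltn_trans (leq_subr _ _) lt_b.
move=> lt_i lt_i' eq_ii'; have [le_i|/ltnW le_i] := leqP i i'.
  exact: sym eq_ii'.
by have [-> ->] := sym _ _ _ _ lt_i le_i (esym eq_ii').
Qed.

Lemma path_traject_uniq u : uniq (traject w (outer_dart u) (len u)).
Proof.
apply/(uniqP (outer_dart u)) => i j; rewrite !inE size_traject => lt_i lt_j.
rewrite !nth_traject //.
by case/(path_start lt_i lt_j).
Qed.

Lemma prod_path_darts (R : comPzRingType) (F : dart n -> R) u :
  \prod_(d in path_darts u) F d = \prod_(i < len u) F (iter i w (outer_dart u)).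
Proof.
transitivity (\prod_(d <- traject w (outer_dart u) (len u)) F d).
  by rewrite big_uniq ?path_traject_uniq //; apply: eq_bigl => d; rewrite inE.
rewrite (big_nth (outer_dart u)) size_traject big_mkord.
by apply: eq_bigr => i _; rewrite nth_traject.
Qed.

Lemma prod_loop_darts (R : comPzRingType) (F : dart n -> R) j :
  \prod_(d in loop_darts j) F d = \prod_(d <- orbit w (false, inl j)) F d.
Proof. by rewrite big_uniq ?orbit_uniq //; apply: eq_bigl => d; rewrite inE. Qed.

Lemma path_darts_disjoint u v :
  u != v -> [disjoint path_darts u & path_darts v].
Proof.
apply: contraNT => /pred0Pn[d /andP[/path_dartsP[i lt_i ->] /path_dartsP[j lt_j]]].
by case/(path_start lt_i lt_j) => ->.
Qed.

Let walk_sym : connect_sym (frel w).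
Proof. exact/fconnect_sym/walk_inj. Qed.

Lemma loop_dart_central j d : loop_at x y j -> fconnect w (false, inl j) d ->
  central d /\ (j <= node_pos d.2)%N.
Proof. by move/loop_atP => loop /iter_findex <-; apply: loop. Qed.

Lemma loop_darts_disjoint j j' : loop_at x y j -> loop_at x y j' ->
  j != j' -> [disjoint loop_darts j & loop_darts j'].
Proof.
move=> lj lj'; apply: contraNT => /pred0Pn[d /andP[]].
rewrite !inE -!fconnect_orbit => jd j'd; apply/eqP/val_inj/anti_leq.
have jj' : fconnect w (false, inl j) (false, inl j').
  by rewrite (connect_trans jd) // walk_sym.
have [_ /= ->] := loop_dart_central lj jj'; rewrite walk_sym in jj'.
by have [_ /= ->] := loop_dart_central lj' jj'.
Qed.

Lemma path_loop_disjoint u j : loop_at x y j ->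
  [disjoint path_darts u & loop_darts j].
Proof.
move=> lj; apply/pred0P => d; apply/negP => /andP[/path_dartsP[i _ ->]].
rewrite !inE -fconnect_orbit walk_sym => H.
have := connect_trans (fconnect_iter w i (outer_dart u)) H.
rewrite walk_sym => /(loop_dart_central lj)[].
by rewrite (negPf (outer_outer_dart u)).
Qed.

Lemma path_darts_end u d :
  (ed d \in path_darts (val (concat x y) u).1) = (d \in path_darts u).
Proof.
have sub v e : e \in path_darts v -> ed e \in path_darts (val (concat x y) v).1.
  case/path_dartsP=> i lt_i ->; apply/path_dartsP; exists (len v - i.+1)%N.
    by rewrite len_partner -subSn // subSS leq_subr.
  rewrite -iter_walk_len iter_walk_rev ?leq_subr //; last first.
    by rewrite iter_walk_len outer_outer_dart.
  by rewrite subKn // iterS glue_walk.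
apply/idP/idP => [/sub|]; last exact: sub.
by rewrite dart_endK diagramK.
Qed.

Lemma fconnect_end e d : fconnect w e d -> fconnect w (ed d) (ed e).
Proof.
by move/iter_findex <-; rewrite -[ed e](iter_walk_end x y (findex w e d)) fconnect_iter.
Qed.

(* The orientation of the strands of x and y along which the strands of the
   product are oriented from their first end, and the loops downwards at their
   leftmost node. *)
Definition path_orientation : {set dart n} :=
  \bigcup_(u | first_end (concat x y) u) path_darts u.

Definition loop_orientation : {set dart n} :=
  \bigcup_(j | loop_at x y j) loop_darts j.

(** If an outer dart reaches [d], then [d] is on a path. Otherwise its whole orbit is central, and
    the leftmost node of the orbit starts a loop through [d] or through its reverse. *)
Lemma path_or_loop d : (exists u, d \in path_darts u) \/
  (exists2 j, loop_at x y j & d \in loop_darts j \/ ed d \in loop_darts j).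
Proof.
have [/existsP[e /andP[eo ed_conn]]|] :=
  boolP [exists e, ~~ central e && fconnect w e d].
  left; have H : exists i, [exists u, iter i w (outer_dart u) == d].
    exists (findex w e d); apply/existsP; exists e.2.
    by rewrite outer_dartK // iter_findex.
  case: (ex_minnP H) => {H}i /existsP[u /eqP du] imin.
  (* A walk longer than the path of [u] could be shortened by starting at the far end of that
     path. *)
  exists u; apply/path_dartsP; exists i => //; rewrite ltnNge; apply/negP => le_i.
  have /imin : [exists v, iter (i - len u) w (outer_dart v) == d].
    apply/existsP; exists (val (concat x y) u).1.
    by rewrite -iter_walk_len -iterD subnK // du.
  by rewrite leqNgt ltn_subrL /= (leq_trans _ le_i).
rewrite negb_exists => /forallP out; right.
have cen e : fconnect w d e -> central e.
  by rewrite walk_sym => de; have := out e; rewrite de andbT negbK.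
have [e de emin] := arg_minnP (fun e :
    dart n => node_pos e.2) (connect0 (frel w) d).
have {}emin e' : fconnect w d e' -> (node_pos e.2 <= node_pos e'.2)%N by apply: emin.
have pos_glue e' : node_pos (glue e').2 = node_pos e'.2 by case: e' => [[] []].
have end_conn i e' : exists e'', fconnect w e' e'' /\ iter i w (ed e') = ed e''.
  have [e'' Ee] : exists e'', iter i w e'' = e'.
    by exists (iter i (finv w) e'); elim: i => //= i IH;
        rewrite -iterS iterSr f_finv //; apply: walk_inj.
  by exists e''; split; [rewrite walk_sym -Ee fconnect_iter|rewrite -Ee iter_walk_end].
(* The dart [(true, inr j)] points upwards from the leftmost node; in that case the reversed loop is
   the one counted. *)
have := cen e de; case Ee: e de emin => [[] [] j] // de emin _.
  exists j; last first.
    right; rewrite inE -fconnect_orbit.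
    have -> : (false, inl j) = w (ed (true, inr j)) by rewrite walk_end.
    by rewrite -same_fconnect1; [apply: fconnect_end | apply: walk_inj].
  apply/loop_atP => i; cbv zeta; have -> : (false, inl j) = w (ed (true, inr j)).
    by rewrite walk_end.
  rewrite -iterSr; have [e'' [ce ->]] := end_conn i.+1 (true, inr j).
  have ce' : fconnect w d (w e'').
    by rewrite -same_fconnect1_r ?(connect_trans de) //; apply: walk_inj.
  rewrite -glue_walk central_glue pos_glue; split; [exact: cen | exact: emin ce'].
exists j; last by left; rewrite inE -fconnect_orbit walk_sym.
apply/loop_atP => i; have di := connect_trans de (fconnect_iter w i _).
by split; [exact: cen | exact: emin di].
Qed.

(** If a strand were used in both directions, the two loops would share their nodes, hence their
    leftmost node; a single loop would then contain a dart and its reverse. *)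
Lemma loop_orientation_end d : d \in loop_orientation ->
  ed d \notin loop_orientation.
Proof.
move=> /bigcupP[j lj dj]; apply/negP => /bigcupP[j' lj' dj'].
move: dj dj'; rewrite !inE -!fconnect_orbit => dj dj'.
have wI := @walk_inj _ _ x y.
have le_end i i' e : loop_at x y i' -> fconnect w (false, inl i) e ->
    fconnect w (false, inl i') (ed e) -> (i' <= i)%N.
  move=> li' /fconnect_end ie i'e; have := connect_trans i'e ie.
  rewrite (same_fconnect1_r wI) walk_end.
  by case/(loop_dart_central li').
have eq_j : j' = j.
  apply/val_inj/anti_leq; rewrite (le_end _ _ _ lj' dj dj') /=.
  by apply: le_end lj dj' _; rewrite dart_endK.
have := connect_trans dj' (fconnect_end dj); rewrite eq_j => /iter_findex.
by apply: end_not_reached => i; have /loop_atP/(_ i)[] := lj.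
Qed.

Lemma path_loop_orientation_disjoint :
  [disjoint path_orientation & loop_orientation].
Proof.
apply/pred0P => d; apply/negP => /andP[/bigcupP[u _ du] /bigcupP[j lj dj]].
by have /pred0P/(_ d) := path_loop_disjoint u lj; rewrite /= du dj.
Qed.

Lemma path_darts_orientation u d : d \in path_darts u ->
  (d \in path_orientation :|: loop_orientation) = first_end (concat x y) u.
Proof.
move=> du; rewrite in_setU; have [fu|fu] := boolP (first_end (concat x y) u).
  by apply/orP; left; apply/bigcupP; exists u.
apply/negbTE; rewrite negb_or; apply/andP; split; apply/bigcupP; case=> v.
  move=> fv dv; case: (eqVneq u v) => [uv|/path_darts_disjoint/pred0P/(_ d)].
    by rewrite uv fv in fu.
  by rewrite /= du dv.
by move=> lv dv; have /pred0P/(_ d) := path_loop_disjoint u lv; rewrite /= du dv.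
Qed.

Lemma orientation_end d :
  (ed d \in path_orientation :|: loop_orientation) =
  (d \notin path_orientation :|: loop_orientation).
Proof.
have [[u du]|[j lj dj]] := path_or_loop d.
  have := du; rewrite -path_darts_end => du'.
  by rewrite (path_darts_orientation du) (path_darts_orientation du') first_end_partner.
have no_path e : e \in loop_orientation -> e \notin path_orientation.
  by move=> eL; rewrite (disjointFl path_loop_orientation_disjoint).
have no_path' e : ed e \in loop_orientation -> e \notin path_orientation.
  move=> eL; apply/negP => /bigcupP[u _]; rewrite -path_darts_end => eu.
  have /bigcupP[i li ei] := eL.
  by have /pred0P/(_ (ed e)) := path_loop_disjoint (val (concat x y) u).1 li;
      rewrite /= eu ei.
have [eL|eL] : d \in loop_orientation \/ ed d \in loop_orientation.
  by case: dj => dj; [left|right]; apply/bigcupP; exists j.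
  have := eL; rewrite -{1}[d](dart_endK x y) => /no_path' nd'.
  by rewrite !in_setU eL orbT (negPf nd') (negPf (loop_orientation_end eL)).
have := loop_orientation_end eL; rewrite dart_endK => nd.
by rewrite !in_setU eL orbT (negPf nd) (negPf (no_path' _ eL)).
Qed.

(** Both sides run over one dart of each strand of [x] and [y], for two orientations: the arbitrary
    one of [first_end] and the one induced by the product. *)
Lemma prod_strands_concat (R : comPzRingType) (F : dart n -> R) :
  (forall d, F (ed d) = F d) ->
  (\prod_(u | first_end x u) F (true, u)) * (\prod_(u | first_end y u) F (false, u)) =
  (\prod_(u | first_end (concat x y) u) \prod_(i < len u) F (iter i w (outer_dart u)))
  * \prod_(j | loop_at x y j) \prod_(d <- orbit w (false, inl j)) F d.
Proof.
move=> Fed; transitivity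
  (\prod_(d | first_end (if d.1 then x else y) d.2) F d).
  rewrite [RHS](eq_bigr (fun d => F (d.1, d.2))); last by case.
  rewrite -(pair_big_dep xpredT (fun b u => first_end (if b then x else y) u)
    (fun b u => F (b, u))) /=.
  by rewrite big_bool.
rewrite (prod_orientation (O' := fun d => d \in path_orientation :|: loop_orientation)
  (dart_endK x y) _ orientation_end Fed); last first.
  by case=> b u; rewrite /= /dart_end /dart_strand /= first_end_partner.
rewrite (bigID (mem path_orientation)) /=; congr (_ * _).
  rewrite (eq_bigl (mem path_orientation)); last first.
    by move=> d; rewrite /= in_setU; case: (d \in path_orientation); rewrite ?andbF.
  rewrite prod_bigcup_disjoint; last by move=> *; apply: path_darts_disjoint.
  by apply: eq_bigr => u _; rewrite prod_path_darts.
rewrite (eq_bigl (mem loop_orientation)); last first.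
  move=> d; rewrite /= in_setU; case dL: (d \in loop_orientation).
    by rewrite orbT (disjointFl path_loop_orientation_disjoint).
  by rewrite orbF andbN.
rewrite prod_bigcup_disjoint; last by move=> *; apply: loop_darts_disjoint.
by apply: eq_bigr => j _; rewrite prod_loop_darts.
Qed.

End Decomposition.

(** * Gauge transformations *)

Lemma diagram_eqP m n (x y : diagram m n) :
  (forall u, (val x u).1 = (val y u).1 /\ (val x u).2 = (val y u).2) -> x = y.
Proof.
move=> xy; apply/val_inj/ffunP => u; have := xy u.
by case: (val x u) (val y u) => [v c] [v' c'] /= [-> ->].
Qed.

Lemma concat_shape m n (x y : diagram m n) u : (val (concat x y) u).1 =
  (iter (walk_length x y (outer_dart u)) (walk x y) (outer_dart u)).2.
Proof. by rewrite ffunE. Qed.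

Lemma concat_label m n (x y : diagram m n) u : (val (concat x y) u).2 =
  \sum_(i < walk_length x y (outer_dart u))
     dart_label x y (iter i (walk x y) (outer_dart u)).
Proof. by rewrite ffunE. Qed.

Section Gauge.

Variables (m n : nat).
Implicit Types (x y : diagram m n) (q h : {ffun node n -> label m}).

(** Antisymmetry in the two ends keeps the labels of the two orientations opposite. *)
Definition gauge_fun q x : {ffun node n -> node n * label m} :=
  [ffun u => ((val x u).1, (val x u).2 + q u - q (val x u).1)].

Lemma gauge_is_diagram q x : is_diagram (gauge_fun q x).
Proof.
apply/forallP => u; rewrite !ffunE /= diagram_neq diagramK /=.
by rewrite xpair_eqE eqxx /= !opprD opprK addrAC.
Qed.

Definition gauge q x : diagram m n := exist _ (gauge_fun q x) (gauge_is_diagram q x).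

Lemma gauge_shape q x : same_shape (gauge q x) x.
Proof. by move=> u; rewrite ffunE. Qed.

Lemma gauge_label q x u :
  (val (gauge q x) u).2 = (val x u).2 + q u - q (val x u).1.
Proof. by rewrite ffunE. Qed.

Lemma gaugeD q h x : gauge (q + h) x = gauge q (gauge h x).
Proof.
apply: diagram_eqP => u; rewrite !gauge_shape !gauge_label gauge_shape.
by split; rewrite // !ffunE opprD !addrA [LHS](ACl (1*3*5*2*4)%AC).
Qed.

(** Gauges act transitively on the labellings of a matching: the whole discrepancy can be placed at
    the first end of each strand. *)
Lemma same_shape_gauge x y : same_shape x y -> exists q, y = gauge q x.
Proof.
move=> xy; exists [ffun u => if first_end x u then (val y u).2 - (val x u).2 else 0].
apply: diagram_eqP => u; rewrite gauge_shape gauge_label !ffunE first_end_partner.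
split; first by rewrite xy.
case: (first_end x u) => /=; first by rewrite subr0 addrC subrK.
have yv := diagramK y u; rewrite -xy in yv.
by rewrite yv diagramK /= addr0 -opprD opprK addrC subrK.
Qed.

Lemma dart_label_gauge x y q q' d :
  let Q (d : dart n) := if d.1 then q d.2 else q' d.2 in
  dart_label (gauge q x) (gauge q' y) d =
  dart_label x y d + Q d - Q (dart_end x y d).
Proof.
by case: d => -[] u; rewrite /dart_label /dart_strand /= gauge_label.
Qed.

Section GaugeConcat.

Variables (x y : diagram m n) (h : {ffun node n -> label m}).
Variable l : {ffun 'I_n -> label m}.

Definition top_gauge : {ffun node n -> label m} :=
  [ffun u => if northern u then h u else 0].

(** The southern part of [h] acts on [y] directly. Each loop receives its label [l j] at its
    leftmost node, on the [y] side only, so that it is counted once and with the sign of the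
    downward orientation. *)
Definition bottom_gauge : {ffun node n -> label m} :=
  [ffun u => match u with
             | inl j => if loop_at x y j then l j else 0
             | inr j => h (inr j)
             end].

Let Q (d : dart n) := if d.1 then top_gauge d.2 else bottom_gauge d.2.

Let shx := gauge_shape top_gauge x.
Let shy := gauge_shape bottom_gauge y.

Let label_Q d : dart_label (gauge top_gauge x) (gauge bottom_gauge y) d =
  dart_label x y d + (Q d - Q (dart_end x y d)).
Proof. by rewrite dart_label_gauge addrA. Qed.

Let Q_path u d : d \in path_darts x y u -> Q d = if central d then 0 else h d.2.
Proof.
case: d => -[] [] j du; rewrite /Q ?ffunE //=; case: ifP => // lj.
have /pred0P/(_ (false, inl j)) := path_loop_disjoint u lj.
by rewrite /= du inE -fconnect_orbit connect0.
Qed.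

(** On a path both gauges vanish at every central dart, because central nodes are gauged only on
    loops; the two outer ends contribute the two terms of [gauge h]. *)
Lemma concat_gauge :
  concat (gauge top_gauge x) (gauge bottom_gauge y) = gauge h (concat x y).
Proof.
apply: diagram_eqP => u; split.
  by rewrite gauge_shape; apply: same_shape_concat.
rewrite gauge_label !concat_label.
rewrite (same_shape_walk_length shx shy) ?outer_outer_dart //.
under eq_bigr => i _ do
  rewrite (eq_iter (same_shape_walk shx shy)) label_Q.
rewrite big_split -addrA; congr (_ + _); rewrite sumrB.
set w := walk x y; set d0 := outer_dart u; set v := (val (concat x y) u).1.
have lt0 : (0 < walk_length x y d0)%N by [].
have d_in (i : nat) : (i < walk_length x y d0)%N ->
    iter i w d0 \in path_darts x y u.
  by move=> lt_i; apply/path_dartsP; exists i.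
have e_in (i : nat) : (i < walk_length x y d0)%N ->
    dart_end x y (iter i w d0) \in path_darts x y v.
  by move=> lt_i; rewrite path_darts_end d_in.
have e_glue (i : nat) : dart_end x y (iter i w d0) = glue (iter i.+1 w d0).
  by rewrite iterS glue_walk.
congr (_ - _).
  have Qd0 : Q d0 = h u.
    by rewrite (Q_path (d_in 0%N lt0)) (negPf (outer_outer_dart u)).
  rewrite (bigD1 (Ordinal lt0)) // [Q _]Qd0 big1; first exact: addr0.
  move=> i ne_i0.
  rewrite (Q_path (d_in _ (ltn_ord i))) iter_walk_central // ltn_ord andbT lt0n.
  by apply: contraNneq ne_i0 => i0; apply/eqP/val_inj.
case E: (walk_length x y d0) lt0 e_in => [//|l'] _ e_in.
have Qlast : Q (dart_end x y (iter l' w d0)) = h v.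
  rewrite (Q_path (e_in l' (leqnn _))) e_glue -E iter_walk_len glue_outer.
    by rewrite (negPf (outer_outer_dart v)).
  exact: outer_outer_dart.
rewrite big_ord_recr [Q (dart_end _ _ (iter ord_max _ _))]Qlast big1.
  exact: add0r.
move=> i _.
rewrite (Q_path (e_in _ (leqW (ltn_ord i)))) e_glue central_glue iter_walk_central //.
by rewrite -/d0 E; exact: (ltn_ord i).
Qed.

(** The start of the orbit is its only gauged dart, while the reverse of a dart of the loop is never
    gauged, as it would then lie on a counted loop. *)
Lemma loop_label_gauge j : loop_at x y j ->
  loop_label (gauge top_gauge x) (gauge bottom_gauge y) j =
  loop_label x y j + l j.
Proof.
move=> lj; rewrite /loop_label; set o := orbit (walk x y) (false, inl j).
rewrite (perm_big o); last first.
  by apply: uniq_perm; rewrite ?orbit_uniq //; apply: same_shape_orbit.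
under eq_bigr => d _ do rewrite label_Q.
rewrite big_split; congr (_ + _); rewrite sumrB big_seq [X in _ - X]big_seq.
have Q_loop d : central d -> Q d = 0 \/
    exists2 j', loop_at x y j' & d = (false, inl j') /\ Q d = l j'.
  case: d => -[] [] i //= _; rewrite /Q /= !ffunE; [by left|].
  by case: ifP => li; [right; exists i | left].
have o_cen d : d \in o -> central d.
  by rewrite -fconnect_orbit => /(loop_dart_central lj)[].
have jo : (false, inl j) \in o by rewrite -fconnect_orbit connect0.
rewrite [X in _ - X]big1 => [|d od]; last first.
  have [|//|[j' lj' [eqd _]]] := Q_loop (dart_end x y d).
    rewrite -glue_walk central_glue o_cen // -fconnect_orbit.
    rewrite -same_fconnect1_r; last exact: walk_inj.
    by rewrite fconnect_orbit.
  have : d \in loop_orientation x y by apply/bigcupP; exists j; rewrite ?inE.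
  case/loop_orientation_end/negP; apply/bigcupP; exists j' => //.
  by rewrite inE eqd -fconnect_orbit connect0.
rewrite subr0 -big_seq (bigD1_seq (false, inl j)) ?orbit_uniq //=.
rewrite [Q _](_ : _ = l j); last by rewrite /Q /= !ffunE lj.
rewrite big_seq_cond big1 ?addr0 // => d /andP[od ne_d].
have [|//|[j' lj' [eqd _]]] := Q_loop d; first exact: o_cen.
have ne_j : j != j' by apply: contraNneq ne_d => ->; rewrite eqd.
have /pred0P/(_ d) := loop_darts_disjoint lj lj' ne_j.
by rewrite /= !inE [_ \in orbit _ _]od eqd -fconnect_orbit connect0.
Qed.

End GaugeConcat.

End Gauge.

(** * Bilinearity of the product *)

Section BasedAlgebra.

Variables (k : fieldType) (A : based_algebra k).
Implicit Types (x y : elt A) (c : k).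

Lemma amulDl x x' y : amul (x + x') y = amul x y + amul x' y.
Proof.
rewrite /amul -big_split; apply: eq_bigr => a _; rewrite -big_split.
by apply: eq_bigr => b _; rewrite ffunE mulrDl scalerDl.
Qed.

Lemma amulDr x y y' : amul x (y + y') = amul x y + amul x y'.
Proof.
rewrite /amul -big_split; apply: eq_bigr => a _; rewrite -big_split.
by apply: eq_bigr => b _; rewrite ffunE mulrDr scalerDl.
Qed.

Lemma amulZl c x y : amul (c *: x) y = c *: amul x y.
Proof.
rewrite /amul scaler_sumr; apply: eq_bigr => a _; rewrite scaler_sumr.
by apply: eq_bigr => b _; rewrite ffunE scalerA mulrA.
Qed.

Lemma amulZr c x y : amul x (c *: y) = c *: amul x y.
Proof.
rewrite /amul scaler_sumr; apply: eq_bigr => a _; rewrite scaler_sumr.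
by apply: eq_bigr => b _; rewrite ffunE scalerA mulrCA.
Qed.

Lemma amul0l y : amul (0 : elt A) y = 0.
Proof. by rewrite -[0 in LHS](scale0r (0 : elt A)) amulZl scale0r. Qed.

Lemma amul0r x : amul x (0 : elt A) = 0.
Proof. by rewrite -[0 in LHS](scale0r (0 : elt A)) amulZr scale0r. Qed.

Lemma amul_suml (I : Type) (r : seq I) (P : pred I) (F : I -> elt A) y :
  amul (\sum_(i <- r | P i) F i) y = \sum_(i <- r | P i) amul (F i) y.
Proof. by elim/big_rec2: _ => [|i u v _ <-]; rewrite ?amul0l ?amulDl. Qed.

Lemma amul_sumr (I : Type) (r : seq I) (P : pred I) (F : I -> elt A) x :
  amul x (\sum_(i <- r | P i) F i) = \sum_(i <- r | P i) amul x (F i).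
Proof. by elim/big_rec2: _ => [|i u v _ <-]; rewrite ?amul0r ?amulDr. Qed.

Lemma amul_basis (a b : basis A) :
  amul (basis_vec k a : elt A) (basis_vec k b) = sc_mul a b.
Proof.
rewrite /amul (bigD1 a) //= [X in _ + X]big1 => [|a' ne_a].
  rewrite addr0 (bigD1 b) //= big1 => [|b' ne_b].
    by rewrite !ffunE !eqxx mulr1 scale1r addr0.
  by rewrite !ffunE (negPf ne_b) mulr0 scale0r.
by rewrite big1 // => b' _; rewrite !ffunE (negPf ne_a) mul0r scale0r.
Qed.

Lemma sum_basis_vec (X : finType) (x : {ffun X -> k^o}) :
  x = \sum_a x a *: basis_vec k a.
Proof.
apply/ffunP => b; rewrite sum_ffunE (bigD1 b) //= big1 => [|a ne_a].
  by rewrite !ffunE eqxx addr0 [RHS]mulr1.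
by rewrite !ffunE eq_sym (negPf ne_a) [LHS]mulr0.
Qed.

Lemma corner_sum (e : elt A) (I : finType) (a : I -> k) (F : I -> elt A) :
  amul (amul e (\sum_i a i *: F i)) e = \sum_i a i *: amul (amul e (F i)) e.
Proof.
rewrite amul_sumr amul_suml.
by apply: eq_bigr => i _; rewrite amulZr amulZl.
Qed.

End BasedAlgebra.

(** * Characters and the vectors spanning the corner *)

Section Characters.

Variables (k : fieldType) (m' n : nat).
Local Notation m := m'.+1.

Section Root.
Variables (a : k) (am : a ^+ m = 1).

Let a_neq0 : a != 0.
Proof. by apply: contra_eq_neq am => ->; rewrite exprS mul0r eq_sym oner_neq0. Qed.

Lemma expr_labelD (c d : label m) : a ^+ (c + d)%R = a ^+ c * a ^+ d.
Proof. by rewrite -exprD /= expr_mod. Qed.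

Lemma expr_labelN (c : label m) : a ^+ (- c)%R = a^-1 ^+ c.
Proof.
apply: (@mulfI _ (a ^+ c)); rewrite ?expf_neq0 // -expr_labelD subrr /=.
by rewrite exprVn divff // expf_neq0.
Qed.

Lemma expr_label_sum (I : Type) (r : seq I) (P : pred I) (F : I -> label m) :
  a ^+ (\sum_(i <- r | P i) F i)%R = \prod_(i <- r | P i) a ^+ F i.
Proof. exact: (big_morph (fun c : label m => a ^+ c) expr_labelD). Qed.

End Root.

Variables (z : 'I_n -> k) (zm : forall i, z i ^+ m = 1).

(* The charge attached to the node u: a strand labelled c when oriented away
   from u is weighted by [charge u ^+ c]. *)
Definition charge (u : node n) : k :=
  match u with inl i => z i | inr i => (z i)^-1 end.

Lemma charge_root u : charge u ^+ m = 1.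
Proof. by case: u => i; rewrite /= ?exprVn zm ?invr1. Qed.

Lemma charge_neq0 u : charge u != 0.
Proof.
by apply: contra_eq_neq (charge_root u) => ->; rewrite exprS mul0r eq_sym oner_neq0.
Qed.

Definition compatible (x : diagram m n) : bool :=
  [forall u, charge (val x u).1 == (charge u)^-1].

Lemma compatibleP (x : diagram m n) :
  reflect (forall u, charge (val x u).1 = (charge u)^-1) (compatible x).
Proof. exact: 'forall_eqP. Qed.

Lemma compatible_shape (x y : diagram m n) :
  same_shape x y -> compatible x = compatible y.
Proof.
by move=> xy; apply/compatibleP/compatibleP => H u; have := H u; rewrite xy.
Qed.

Lemma compatible_id : compatible (id_diagram m n).
Proof. by apply/compatibleP => -[] i; rewrite ffunE //= invrK. Qed.

Section Concat.

Variables (x y : diagram m n).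
Hypotheses (cx : compatible x) (cy : compatible y).

Lemma charge_end d : charge (dart_end x y d).2 = (charge d.2)^-1.
Proof. by case: d => -[] u; [apply: (compatibleP x cx)
    | apply: (compatibleP y cy)]. Qed.

Lemma charge_glue d : central d -> charge (glue d).2 = (charge d.2)^-1.
Proof. by case: d => [[] []] i //= _; rewrite invrK. Qed.

(** A step inverts the charge twice, along the strand and across the gluing. *)
Lemma charge_walk d : central (walk x y d) -> charge (walk x y d).2 = charge d.2.
Proof.
by rewrite /walk central_glue => cen; rewrite charge_glue // charge_end invrK.
Qed.

Lemma charge_path u (i : nat) : (i < walk_length x y (outer_dart u))%N ->
  charge (iter i (walk x y) (outer_dart u)).2 = charge u.
Proof.
elim: i => // i IH lt_i; rewrite iterS charge_walk ?IH ?(ltnW lt_i) //.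
by rewrite -iterS iter_walk_central.
Qed.

Lemma charge_loop j d : loop_at x y j -> d \in orbit (walk x y) (false, inl j) ->
  charge d.2 = z j.
Proof.
move/loop_atP=> lj; rewrite -fconnect_orbit => /iter_findex <-.
elim: (findex _ _ _) => // i IH; rewrite iterS charge_walk ?IH //.
by rewrite -iterS; have [] := lj i.+1.
Qed.

Lemma compatible_concat : compatible (concat x y).
Proof.
apply/compatibleP => u; have := iter_walk_len x y u.
have [wout _] := walk_lengthP x y (outer_outer_dart u).
have : (0 < walk_length x y (outer_dart u))%N by [].
have := @charge_path u (walk_length x y (outer_dart u)).-1.
case: (walk_length x y (outer_dart u)) wout => //= l wout /(_ (leqnn _)) <- _.
move=> E; have -> : (val (concat x y) u).1 =
    (walk x y (iter l (walk x y) (outer_dart u))).2 by rewrite E.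
by rewrite /walk glue_outer ?charge_end // -central_glue.
Qed.

End Concat.

(** Independent of the choice of first ends when [x] is compatible: reversing a strand inverts the
    charge and negates the label. *)
Definition weight (x : diagram m n) : k :=
  \prod_(u | first_end x u) charge u ^+ (val x u).2.

Definition gauge_weight (q : {ffun node n -> label m}) : k :=
  \prod_u charge u ^+ q u.

Lemma weight_neq0 x : weight x != 0.
Proof.
apply/prodf_neq0 => u _; exact/expf_neq0/charge_neq0.
Qed.

(** The term [- q v] at the first end of a strand counts as [q v] at its other end [v], whose charge
    is the inverse. *)
Lemma weight_gauge q x : compatible x ->
  weight (gauge q x) = weight x * gauge_weight q.
Proof.
move=> /compatibleP cx; rewrite /gauge_weight (bigID (first_end x)) /=.
rewrite [X in _ * (_ * X)](reindex_inj (h := fun u => (val x u).1)); last first.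
  by apply: (can_inj (g := fun u => (val x u).1)) => u; rewrite diagramK.
rewrite [X in _ * (_ * X)](eq_bigl (first_end x)); last first.
  by move=> u; rewrite first_end_partner negbK.
rewrite -!big_split /=; apply: eq_big => [u|u _];
    first by rewrite /first_end gauge_shape.
rewrite gauge_label !expr_labelD ?charge_root // mulrA; congr (_ * _).
by rewrite cx expr_labelN // charge_root.
Qed.

Lemma weight_concat x y : compatible x -> compatible y ->
  weight x * weight y = weight (concat x y) *
    \prod_(j | loop_at x y j) z j ^+ loop_label x y j.
Proof.
move=> cx cy; have := prod_strands_concat (x := x) (y := y)
   (F := fun d => charge d.2 ^+ dart_label x y d).
rewrite /weight => ->; last first.
  move=> d; rewrite (charge_end cx cy) dart_label_end expr_labelN ?invrK //.
  by rewrite exprVn charge_root invr1.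
congr (_ * _); apply: eq_bigr.
  move=> u _; rewrite concat_label expr_label_sum ?charge_root //.
  by apply: eq_bigr => i _; rewrite (charge_path cx cy).
move=> j lj; rewrite /loop_label expr_label_sum // big_seq [RHS]big_seq.
by apply: eq_bigr => d /(charge_loop cx cy lj) ->.
Qed.

Variable delta : m.-tuple k.
Hypothesis m_unit : m%:R != 0 :> k.
Local Notation A := (cyclotomic_brauer n delta).
Local Notation N := (#|{: {ffun node n -> label m}}|%:R : k).

(** A multiple of e x e for compatible [x], normalised so as to depend on the matching alone. The
    sum is over gauges and not over labellings, so that shifts of [q] act as reindexings; [N] is the
    number of gauges. *)
Definition corner_vec (x : diagram m n) : elt A :=
  N^-1 *: \sum_q weight (gauge q x) *: basis_vec k (gauge q x).

Definition loop_value (j : 'I_n) : k := m%:R^-1 * \sum_(c < m) z j ^+ c * delta`_c.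

Lemma card_gauge_neq0 (I : finType) : #|{: {ffun I -> label m}}|%:R != 0 :> k.
Proof. by rewrite card_ffun card_ord natrX expf_neq0. Qed.

Lemma corner_vec_gauge q x : corner_vec (gauge q x) = corner_vec x.
Proof.
rewrite /corner_vec; congr (_ *: _); rewrite [RHS](reindex_inj (addIr q)) /=.
by apply: eq_bigr => h _; rewrite gaugeD.
Qed.

Lemma corner_vec_shape x y : same_shape x y -> corner_vec x = corner_vec y.
Proof. by move=> /same_shape_gauge[q ->]; rewrite corner_vec_gauge. Qed.

(** A product of sums over independent labels: an index outside [P] contributes a free factor [m],
    an index inside it [m] times the average. *)
Lemma sum_loop_labels (P : pred 'I_n) (c : 'I_n -> label m) :
  \sum_(l : {ffun 'I_n -> label m})
     \prod_(j | P j) (z j ^+ (c j + l j)%R * delta`_(c j + l j)%R) =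
  #|{: {ffun 'I_n -> label m}}|%:R * \prod_(j | P j) loop_value j.
Proof.
pose F j (b : label m) :=
  if P j then z j ^+ (c j + b)%R * delta`_(c j + b)%R else 1.
transitivity (\sum_(l : {ffun 'I_n -> label m}) \prod_j F j (l j)).
  by apply: eq_bigr => l _; rewrite [LHS]big_mkcond.
rewrite -(bigA_distr_bigA F) card_ffun !card_ord natrX /=.
rewrite [X in _ = _ * X]big_mkcond -[n in _ ^+ n]card_ord -prodr_const.
rewrite -big_split; apply: eq_bigr => j _; rewrite /F /=.
case: (P j); last by rewrite sumr_const card_ord mulr1.
by rewrite mulrA divff // mul1r [RHS](reindex_inj (addrI (c j))).
Qed.

(** For fixed [q] and [q'], summing over the shifts by [h] and [l] already gives the right-hand side
    up to a constant, since [h] runs over all gauges of the product and [l] over all labels of the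
    loops. *)
Lemma amul_corner_vec x y : compatible x -> compatible y ->
  amul (corner_vec x) (corner_vec y) =
  (\prod_(j | loop_at x y j) loop_value j) *: corner_vec (concat x y).
Proof.
move=> cx cy.
pose R q q' : elt A := (weight (gauge q x) * weight (gauge q' y)) *:
  sc_mul (gauge q x : basis A) (gauge q' y).
have -> : amul (corner_vec x) (corner_vec y) = (N^-1 * N^-1) *:
    \sum_q \sum_q' R q q'.
  rewrite amulZl amulZr scalerA; congr (_ *: _).
  rewrite amul_suml; apply: eq_bigr => q _; rewrite amul_sumr.
  by apply: eq_bigr => q' _; rewrite amulZl amulZr amul_basis scalerA.
have RE q q' (h : {ffun node n -> label m}) (l : {ffun 'I_n -> label m}) :
    R (top_gauge h + q) (bottom_gauge x y h l + q') =
    (\prod_(j | loop_at x y j) (z j ^+ (loop_label (gauge q x) (gauge q' y) j + l j)%R *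
      delta`_(loop_label (gauge q x) (gauge q' y) j + l j)%R)) *:
    (weight (gauge h (concat (gauge q x) (gauge q' y))) *:
      basis_vec k (gauge h (concat (gauge q x) (gauge q' y)))).
  have shq := gauge_shape q x; have shq' := gauge_shape q' y.
  (* Bottom gauges depend only on the matchings, so one shift serves all [q] and [q']. *)
  have -> : bottom_gauge x y h l = bottom_gauge (gauge q x) (gauge q' y) h l.
    apply/ffunP => -[] j; rewrite !ffunE //.
    by rewrite (same_shape_loop_at shq shq').
  rewrite /R !gaugeD; set X := gauge q x; set Y := gauge q' y.
  set X' := gauge _ X; set Y' := gauge _ Y.
  have lE j : loop_at X' Y' j = loop_at x y j.
    rewrite (same_shape_loop_at (gauge_shape _ X) (gauge_shape _ Y)).
    exact: same_shape_loop_at.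
  rewrite weight_concat; last first.
  - by rewrite (compatible_shape (gauge_shape _ _))
      (compatible_shape (gauge_shape _ _)).
  - by rewrite (compatible_shape (gauge_shape _ _))
      (compatible_shape (gauge_shape _ _)).
  rewrite /= /loop_scalar concat_gauge !scalerA -mulrA mulrC; congr (_ * _ *: _).
  rewrite -big_split; apply: eq_big => // j; rewrite lE => lj.
  by rewrite loop_label_gauge // ?(same_shape_loop_at shq shq') // mulrC.
set K := (#|{: {ffun 'I_n -> label m}}|%:R : k).
set S := \sum_q \sum_q' R q q'; set V := corner_vec (concat x y).
have S_shift h l :
    S = \sum_q \sum_q' R (top_gauge h + q) (bottom_gauge x y h l + q').
  rewrite /S (reindex_inj (addrI (top_gauge h))) /=; apply: eq_bigr => q _.
  by rewrite (reindex_inj (addrI (bottom_gauge x y h l))).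
have sum_R q q' : \sum_h \sum_l R (top_gauge h + q) (bottom_gauge x y h l + q') =
    (K * \prod_(j | loop_at x y j) loop_value j * N) *: V.
  set C := concat (gauge q x) (gauge q' y).
  transitivity (\sum_h (K * \prod_(j | loop_at x y j) loop_value j) *:
      (weight (gauge h C) *: basis_vec k (gauge h C)) : elt A).
    apply: eq_bigr => h _.
    rewrite -(sum_loop_labels _ (loop_label (gauge q x) (gauge q' y))) scaler_suml.
    by apply: eq_bigr => l _; exact: RE.
  rewrite -scaler_sumr -[RHS]scalerA; congr (_ *: _).
  rewrite /V -(corner_vec_shape (same_shape_concat (gauge_shape q x) (gauge_shape q' y))).
  by rewrite /corner_vec scalerA divff ?scale1r // card_gauge_neq0.
(* The sum over [(q, q')] and [(h, l)] is evaluated twice: by invariance of [S] under each shift,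
   and by summing over the shifts first. *)
have : \sum_(h : {ffun node n -> label m}) \sum_(l : {ffun 'I_n -> label m}) S =
    \sum_(q : {ffun node n -> label m}) \sum_(q' : {ffun node n -> label m})
      (K * \prod_(j | loop_at x y j) loop_value j * N) *: V.
  transitivity (\sum_h \sum_q \sum_l \sum_q'
      R (top_gauge h + q) (bottom_gauge x y h l + q')).
    apply: eq_bigr => h _; rewrite [RHS]exchange_big; apply: eq_bigr => l _.
    exact: S_shift.
  rewrite exchange_big; apply: eq_bigr => q _ /=.
  transitivity (\sum_h \sum_q' \sum_l
      R (top_gauge h + q) (bottom_gauge x y h l + q')).
    by apply: eq_bigr => h _; apply: exchange_big.
  by rewrite exchange_big; apply: eq_bigr => q' _; rewrite sum_R.
set p := \prod_(j | _) _.
clearbody V; rewrite !sumr_const -!scaler_nat !scalerA => eqS.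
have {}eqS : (N * K) *: S = (N * N * (K * p * N)) *: V by exact: eqS.
have N0 : N != 0 by apply: card_gauge_neq0.
have K0 : K != 0 by apply: card_gauge_neq0.
apply: (@scalerI _ _ (N * K)); first by rewrite mulf_neq0.
rewrite scalerA [X in X *: S]mulrC -[LHS]scalerA eqS !scalerA; congr (_ *: _).
by field.
Qed.

End Characters.

(** * The idempotent and its two-sided action *)

Section Identity.

Variables (m n : nat).
Implicit Types (x y : diagram m n).

Lemma id_shape u : (val (id_diagram m n) u).1 =
  match u with inl i => inr i | inr i => inl i end.
Proof. by rewrite ffunE. Qed.

Lemma gauge0 x : gauge 0 x = x.
Proof.
apply: diagram_eqP => u; rewrite gauge_shape gauge_label !ffunE.
by rewrite addr0 subr0.
Qed.

Lemma loop_at_idl x y j : same_shape x (id_diagram m n) -> loop_at x y j = false.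
Proof.
move=> sx; apply/negP => /loop_atP loop.
have := loop 2; have := loop 1%N; rewrite /= /walk /dart_end /dart_strand /=.
case: (fst (val y (inl j))) => i [] //= _ _.
by rewrite sx id_shape /= => -[].
Qed.

Lemma loop_at_idr x y j : same_shape y (id_diagram m n) -> loop_at x y j = false.
Proof.
move=> sy; apply/negP => /loop_atP /(_ 1%N) [].
by rewrite /= /walk /dart_end /dart_strand /= sy id_shape.
Qed.

Lemma concat_idl y : concat (id_diagram m n) y = y.
Proof.
set e := id_diagram m n.
have wT (b : 'I_n) : walk e y (true, inl b) = (false, inl b).
  by rewrite /walk /dart_end /dart_strand /= ffunE.
have wT' (b : 'I_n) : walk e y (true, inr b) = (true, inl b).
  by rewrite /walk /dart_end /dart_strand /= ffunE.
have wF u : walk e y (false, u) = match (val y u).1 with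
    inl b => (true, inr b) | inr b => (false, inr b) end.
  by rewrite /walk /dart_end /dart_strand /=; case: (fst (val y u)).
have lT u : dart_label e y (true, u) = 0.
  by rewrite /dart_label /dart_strand /= ffunE.
have lF u : dart_label e y (false, u) = (val y u).2 by [].
apply: diagram_eqP => u; rewrite concat_shape concat_label.
have shp l d : ~~ central d -> (0 < l)%N -> ~~ central (iter l (walk e y) d) ->
  (forall i, (0 < i < l)%N -> central (iter i (walk e y) d)) ->
      walk_length e y d = l.
  exact: walk_length_unique.
(* The path from [u] has length one plus the number of northern ends of the strand of [y] at [u]:
   each adds a vertical strand of the identity. *)
case Ey: (val y u).1 => [b|b]; case: u Ey => a Ey.
- rewrite (shp 3 (outer_dart (inl a))) ?outer_outer_dart //=;
    rewrite ?wT ?wF ?Ey ?wT' //.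
    by rewrite !big_ord_recl big_ord0 /= wT wF Ey !lT lF add0r !addr0.
  by case=> [|[|[|]]] //= _; rewrite ?wT ?wF ?Ey.
- rewrite (shp 2 (outer_dart (inr a))) ?outer_outer_dart //=;
    rewrite ?wT ?wF ?Ey ?wT' //.
    by rewrite !big_ord_recl big_ord0 /= wF Ey !lT lF !addr0.
  by case=> [|[|]] //= _; rewrite ?wT ?wF ?Ey.
- rewrite (shp 2 (outer_dart (inl a))) ?outer_outer_dart //=;
    rewrite ?wT ?wF ?Ey ?wT' //.
    by rewrite !big_ord_recl big_ord0 /= wT !lT lF add0r !addr0.
  by case=> [|[|]] //= _; rewrite ?wT ?wF ?Ey.
- rewrite (shp 1 (outer_dart (inr a))) ?outer_outer_dart //=;
    rewrite ?wT ?wF ?Ey ?wT' //.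
    by rewrite !big_ord_recl big_ord0 /= lF !addr0.
  by case=> [|[|]].
Qed.

Lemma concat_idr x : concat x (id_diagram m n) = x.
Proof.
set e := id_diagram m n.
have wF (b : 'I_n) : walk x e (false, inl b) = (false, inr b).
  by rewrite /walk /dart_end /dart_strand /= ffunE.
have wF' (b : 'I_n) : walk x e (false, inr b) = (true, inr b).
  by rewrite /walk /dart_end /dart_strand /= ffunE.
have wT u : walk x e (true, u) = match (val x u).1 with
    inl b => (true, inl b) | inr b => (false, inl b) end.
  by rewrite /walk /dart_end /dart_strand /=; case: (fst (val x u)).
have lF u : dart_label x e (false, u) = 0.
  by rewrite /dart_label /dart_strand /= ffunE.
have lT u : dart_label x e (true, u) = (val x u).2 by [].
apply: diagram_eqP => u; rewrite concat_shape concat_label.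
have shp l d : ~~ central d -> (0 < l)%N -> ~~ central (iter l (walk x e) d) ->
  (forall i, (0 < i < l)%N -> central (iter i (walk x e) d)) ->
      walk_length x e d = l.
  exact: walk_length_unique.
case Ex: (val x u).1 => [b|b]; case: u Ex => a Ex.
- rewrite (shp 1 (outer_dart (inl a))) ?outer_outer_dart //=;
    rewrite ?wT ?wF ?Ex ?wF' //.
    by rewrite !big_ord_recl big_ord0 /= lT !addr0.
  by case=> [|[|]].
- rewrite (shp 2 (outer_dart (inr a))) ?outer_outer_dart //=;
    rewrite ?wF' ?wT ?wF ?Ex //.
    by rewrite !big_ord_recl big_ord0 /= wF' !lF lT add0r !addr0.
  by case=> [|[|]] //= _; rewrite ?wF' ?wT ?wF ?Ex.
- rewrite (shp 2 (outer_dart (inl a))) ?outer_outer_dart //=;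
    rewrite ?wF' ?wT ?Ex /= ?wF //.
    by rewrite !big_ord_recl big_ord0 /= wT Ex !lF lT !addr0.
  by case=> [|[|]] //= _; rewrite ?wF' ?wT ?wF ?Ex.
- rewrite (shp 3 (outer_dart (inr a))) ?outer_outer_dart //=;
    rewrite ?wF' ?wT ?Ex /= ?wF //.
    by rewrite !big_ord_recl big_ord0 /= wF' wT Ex !lF lT add0r !addr0.
  by case=> [|[|[|]]] //= _; rewrite ?wF' ?wT ?wF ?Ex.
Qed.

Implicit Types q : {ffun 'I_n -> label m}.

Definition north q : {ffun node n -> label m} :=
  [ffun u => if u is inl i then q i else 0].

(** The label of a downward strand is read with the opposite sign from its southern end. *)
Definition south q : {ffun node n -> label m} :=
  [ffun u => if u is inr i then - q i else 0].

(* The product of the t_i^(q i). *)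
Definition twists q : diagram m n := gauge (north q) (id_diagram m n).

Lemma twists_south q : twists q = gauge (south q) (id_diagram m n).
Proof.
apply: diagram_eqP => u; rewrite !gauge_shape !gauge_label id_shape; split=> //.
by case: u => i; rewrite !ffunE ?sub0r ?subr0 ?add0r ?addr0 ?opprK.
Qed.

(** The case of [concat_gauge] where the upper factor is the identity. *)
Lemma concat_twistsl q x : concat (twists q) x = gauge (north q) x.
Proof.
have := @concat_gauge _ _ (id_diagram m n) x (north q) 0.
rewrite concat_idl => <-; congr concat.
  by congr gauge; apply/ffunP => -[] i; rewrite !ffunE.
rewrite -{1}[x]gauge0; congr gauge; apply/ffunP => -[] i; rewrite !ffunE //.
by case: ifP.
Qed.

Lemma concat_twistsr q x : concat x (twists q) = gauge (south q) x.
Proof.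
have := @concat_gauge _ _ x (id_diagram m n) (south q) 0.
rewrite concat_idr => <-; congr concat.
  by rewrite -{1}[x]gauge0; congr gauge; apply/ffunP => -[] i; rewrite !ffunE.
rewrite twists_south; congr gauge; apply/ffunP => -[] i; rewrite !ffunE //.
by case: ifP.
Qed.

Lemma twistsD q q' : concat (twists q) (twists q') = twists (q + q').
Proof.
rewrite concat_twistsl -gaugeD; congr gauge.
by apply/ffunP => -[] i; rewrite !ffunE ?addr0.
Qed.

Variables (k : fieldType) (delta : m.-tuple k).
Local Notation A := (cyclotomic_brauer n delta).

Lemma sc_mul_twistsl q x :
  sc_mul (twists q : basis A) x = basis_vec k (gauge (north q) x).
Proof.
rewrite /= concat_twistsl /loop_scalar big_pred0 ?scale1r // => j.
by rewrite loop_at_idl //; apply: gauge_shape.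
Qed.

Lemma sc_mul_twistsr q x :
  sc_mul (x : basis A) (twists q) = basis_vec k (gauge (south q) x).
Proof.
rewrite /= concat_twistsr /loop_scalar big_pred0 ?scale1r // => j.
by rewrite loop_at_idr //; apply: gauge_shape.
Qed.

End Identity.

Section Idempotent.

Variables (k : fieldType) (m' n : nat).
Local Notation m := m'.+1.
Variables (z : 'I_n -> k) (zm : forall i, z i ^+ m = 1).
Variable delta : m.-tuple k.
Hypothesis m_unit : m%:R != 0 :> k.
Local Notation A := (cyclotomic_brauer n delta).

(** The coefficient of t_i^c in the averaged idempotent at [i] when [i] is in [S], and in the
    identity otherwise. *)
Definition idem_coef (S : {set 'I_n}) (i : 'I_n) (c : label m) : k :=
  if i \in S then m%:R^-1 * z i ^+ c else (c == 0)%:R.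

Lemma idem_coef_in (S : {set 'I_n}) i (c : label m) : i \in S ->
    idem_coef S i c = m%:R^-1 * z i ^+ c.
Proof. by rewrite /idem_coef => ->. Qed.

Lemma idem_coef_out (S : {set 'I_n}) i (c : label m) : i \notin S ->
    idem_coef S i c = (c == 0)%:R.
Proof. by rewrite /idem_coef => /negPf ->. Qed.

Definition twist_idem (S : {set 'I_n}) : elt A :=
  \sum_(q : {ffun 'I_n -> label m}) (\prod_i idem_coef S i (q i)) *:
      basis_vec k (twists q).

Lemma twist_idem0 : twist_idem set0 = aone A.
Proof.
rewrite /twist_idem (bigD1 (0 : {ffun 'I_n ->
    label m})) //= [X in _ + X]big1 => [|q ne_q0].
  rewrite big1 => [|i _]; last by rewrite /idem_coef inE ffunE eqxx.
  rewrite scale1r addr0; congr (basis_vec k _).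
  rewrite -[RHS]gauge0; congr gauge; apply/ffunP => -[] i; rewrite !ffunE //.
have [i qi] : exists i, q i != 0.
  apply/existsP; apply: contra_neqT ne_q0; rewrite negb_exists => /forallP H.
  by apply/ffunP => i; rewrite ffunE; apply/eqP/negPn/H.
by rewrite (bigD1 i) //= /idem_coef inE (negPf qi) mul0r scale0r.
Qed.

(** Convolution on Z/m: the indicator of 0 is neutral and the normalised character is idempotent. *)
Lemma idem_coef_conv (S S' : {set 'I_n}) i (b : label m) :
  \sum_a idem_coef S i a * idem_coef S' i (b - a) = idem_coef (S :|: S') i b.
Proof.
have [iS|iS] := boolP (i \in S); last first.
  rewrite (bigD1 0) // big1 => [|a ne_a].
    rewrite (idem_coef_out _ iS) eqxx mul1r subr0 /idem_coef in_setU (negPf iS).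
    exact: addr0.
  by rewrite (idem_coef_out _ iS) (negPf ne_a) mul0r.
rewrite [RHS]idem_coef_in ?inE ?iS //; have [iS'|iS'] := boolP (i \in S').
  transitivity (\sum_(a : label m) m%:R^-1 * (m%:R^-1 * z i ^+ b)).
    apply: eq_bigr => a _; rewrite !idem_coef_in //.
    have -> : z i ^+ b = z i ^+ (b - a)%R * z i ^+ a by rewrite -expr_labelD ?subrK.
    by rewrite mulrACA [_ * z i ^+ a]mulrC -mulrA.
  by rewrite sumr_const card_ord -[LHS]mulr_natl mulrA divff // mul1r.
rewrite (bigD1 b) // big1 => [|a ne_a].
  rewrite (idem_coef_in _ iS) (idem_coef_out _ iS') subrr eqxx mulr1.
  exact: addr0.
by rewrite (idem_coef_out _ iS') subr_eq0 eq_sym (negPf ne_a) mulr0.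
Qed.

Lemma amul_twist_idem (S S' : {set 'I_n}) :
  amul (twist_idem S) (twist_idem S') = twist_idem (S :|: S').
Proof.
rewrite {1}/twist_idem amul_suml.
transitivity (\sum_(q : {ffun 'I_n -> label m}) \sum_(q' : {ffun 'I_n -> label m})
   (\prod_i (idem_coef S i (q i) *
    idem_coef S' i ((q' - q) i))) *: (basis_vec k (twists q') : elt A)).
  apply: eq_bigr => q _; rewrite amul_sumr [RHS](reindex_inj (addrI q)) /=.
  apply: eq_bigr => q' _; rewrite amulZl amulZr scalerA -big_split.
  rewrite amul_basis sc_mul_twistsl -concat_twistsl twistsD; congr (_ *: _).
  by apply: eq_bigr => i _; rewrite !ffunE [q i + _]addrC addrK.
rewrite exchange_big; apply: eq_bigr => q' _; rewrite -scaler_suml /=.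
congr (_ *: _); transitivity (\prod_i \sum_a (idem_coef S i a *
    idem_coef S' i (q' i - a))).
  by rewrite bigA_distr_bigA; apply: eq_bigr => q _; apply: eq_bigr => i _;
      rewrite !ffunE.
by apply: eq_bigr => i _; rewrite idem_coef_conv.
Qed.

(** Products of these elements are again of this form, so the bracketing prescribed by the big
    operator is followed step by step, with no appeal to associativity. *)
Lemma big_twist_idem (I : Type) (s : seq I) (P : pred I) (S : I -> {set 'I_n})
    (F : I -> elt A) : (forall i, P i -> F i = twist_idem (S i)) ->
  \big[@amul k A/aone A]_(i <- s | P i) F i =
  twist_idem (\bigcup_(i <- s | P i) S i).
Proof.
move=> FE; elim: s => [|a s IH]; first by rewrite !big_nil twist_idem0.
by rewrite !big_cons; case: ifP => // Pa; rewrite FE // IH amul_twist_idem.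
Qed.

Lemma Tidem_twist_idem xi i r : xi ^+ r = z i ->
  Tidem delta xi i r = twist_idem [set i].
Proof.
move=> xir; pose f (a : label m) : {ffun 'I_n -> label m} :=
  [ffun j => if j == i then a else 0].
have -> : twist_idem [set i] =
    \sum_(a : label m) (m%:R^-1 * z i ^+ a) *: (basis_vec k (twist i a) : elt A).
  (* Only the tuples supported at [i] have a nonzero coefficient. *)
  rewrite /twist_idem (bigID (fun q : {ffun 'I_n ->
      label m} => q == f (q i))) /= [X in _ + X]big1 ?addr0.
    rewrite (reindex_onto f (fun q : {ffun 'I_n ->
        label m} => q i)) /= => [|q /eqP]; last by move<-.
    apply: eq_big => [a|a _]; first by rewrite !ffunE eqxx !eqxx.
    congr (_ *: basis_vec k _).
      rewrite (bigD1 i) //= big1 ?mulr1 => [|j ne_ji].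
        by rewrite /idem_coef inE !ffunE eqxx.
      by rewrite /idem_coef inE (negPf ne_ji) ffunE (negPf ne_ji) eqxx.
    apply: diagram_eqP => u; rewrite gauge_shape gauge_label id_shape ffunE.
    case: u => j; rewrite !ffunE; split=> //; rewrite !add0r ?subr0 //.
    by case: (j == i); rewrite ?oppr0.
  move=> q; have [j qj|H] := pickP (fun j => (j != i) && (q j != 0)).
    case/andP: qj => ne_ji qj _; rewrite (bigD1 j) //= /idem_coef inE.
    by rewrite (negPf ne_ji) (negPf qj) mul0r scale0r.
  case/eqP; apply/ffunP => j; rewrite ffunE; have := H j.
  by case: eqVneq => [->|_ /= /negbFE/eqP].
rewrite /Tidem scaler_sumr.
under [RHS]eq_bigr => a _ do rewrite -scalerA.
(* The sum defining the idempotent runs from 1 to [m], the labels from 0 to [m - 1]; the term of [m]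
   is that of 0. *)
have G0 : m%:R^-1 *: (xi ^+ (m * r) *: basis_vec k (twist i (inZp m : label m))) =
    m%:R^-1 *: (xi ^+ (0 * r) *: basis_vec k (twist i (inZp 0 : label m))).
  congr (_ *: (_ *: basis_vec k (twist i _))).
    by rewrite mulnC mul0n exprM xir zm.
  by apply: val_inj; rewrite /= modnn mod0n.
rewrite big_nat_recr //= G0 addrC.
transitivity (\sum_(0 <= q < m) m%:R^-1 *:
    (xi ^+ (q * r) *: basis_vec k (twist i (inZp q : label m)))).
  by rewrite [RHS]big_ltn.
rewrite big_mkord; apply: eq_bigr => a _;
    congr (_ *: (_ *: basis_vec k (twist i _))).
  by rewrite mulnC exprM xir.
by rewrite valZpK.
Qed.

Local Notation e := (twist_idem [set: 'I_n]).
Local Notation N := (#|{: {ffun node n -> label m}}|%:R : k).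

(** Twists above gauge the northern nodes and twists below the southern ones, so pairs of twists
    correspond bijectively to gauges. *)
Lemma corner_basis x : amul (amul e (basis_vec k x)) e =
  N^-1 *: \sum_q gauge_weight z q *: basis_vec k (gauge q x).
Proof.
pose K := (m%:R ^+ n : k).
have eE : e = K^-1 *: \sum_(q : {ffun 'I_n ->
    label m}) (\prod_i z i ^+ q i) *: basis_vec k (twists q) :> elt A.
  rewrite scaler_sumr; apply: eq_bigr => q _; rewrite scalerA; congr (_ *: _).
  rewrite /K -exprVn -[n in _ ^+ n]card_ord -prodr_const -big_split.
  by apply: eq_bigr => i _; rewrite /idem_coef inE.
rewrite {1}eE amulZl amul_suml amulZl amul_suml {1}eE.
have NE : N = K * K.
  by rewrite card_ffun card_sum !card_ord natrX exprD.
rewrite NE invfM -scalerA; congr (_ *: _); rewrite [RHS]scaler_sumr.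
rewrite [RHS](reindex (fun p : {ffun 'I_n -> label m} * {ffun 'I_n -> label m} =>
   south p.2 + north p.1)); last first.
  exists (fun h : {ffun node n -> label m} =>
    ([ffun i : 'I_n => h (inl i)], [ffun i : 'I_n => - h (inr i)])).
    case=> q q' _; congr pair; apply/ffunP => i; rewrite !ffunE ?add0r //.
    by rewrite addr0 opprK.
  move=> h _; apply/ffunP => -[] i; rewrite !ffunE ?add0r //=.
  by rewrite addr0 opprK.
transitivity (\sum_(q : {ffun 'I_n -> label m}) \sum_(q' : {ffun 'I_n -> label m})
    K^-1 *: (gauge_weight z (south q' + north q) *:
      basis_vec k (gauge (south q' + north q) x) : elt A));
          last by rewrite pair_bigA.
apply: eq_bigr => q _; rewrite amulZr amul_sumr -scaler_sumr; congr (_ *: _).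
apply: eq_bigr => q' _.
rewrite !amulZl amulZr !amul_basis sc_mul_twistsl amul_basis sc_mul_twistsr -gaugeD.
rewrite scalerA; congr (_ *: _); rewrite /gauge_weight big_sumType /=;
    congr (_ * _).
  by apply: eq_bigr => i _; rewrite !ffunE add0r.
apply: eq_bigr => i _; rewrite !ffunE addr0 expr_labelN ?invrK //.
by rewrite exprVn zm invr1.
Qed.

Lemma corner_basis_compatible x : compatible z x ->
  amul (amul e (basis_vec k x)) e = (weight z x)^-1 *: corner_vec z delta x.
Proof.
move=> cx; rewrite corner_basis /corner_vec scalerA [_^-1 * _]mulrC -scalerA.
congr (_ *: _); rewrite scaler_sumr; apply: eq_bigr => q _.
by rewrite weight_gauge // scalerA mulKf // weight_neq0.
Qed.

Lemma corner_vec_id : corner_vec z delta (id_diagram m n) = e.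
Proof.
have w1 : weight z (id_diagram m n) = 1.
  by rewrite /weight big1 // => u _; rewrite ffunE expr0.
rewrite -[LHS]scale1r -invr1 -w1 -corner_basis_compatible ?compatible_id //.
rewrite -[basis_vec k _]/(aone A) -twist_idem0 !amul_twist_idem.
by rewrite setU0 setUid.
Qed.

(** Gauging by 1 at both ends of a strand that violates compatibility fixes [x] but multiplies the
    weight by the product of the two charges, which is not 1; hence the sum vanishes. *)
Lemma corner_basis_incompatible x : ~~ compatible z x ->
  amul (amul e (basis_vec k x)) e = 0.
Proof.
rewrite negb_forall => /existsP[u cu]; rewrite corner_basis.
set v := (val x u).1 in cu *; set S := \sum_q _.
pose h : {ffun node n -> label m} := [ffun t => if (t == u) || (t == v) then inZp 1 else 0].
have hx : gauge h x = x.
  apply: diagram_eqP => t; rewrite gauge_shape gauge_label; split=> //.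
  rewrite -addrA -[RHS]addr0; congr (_ + _); apply/eqP; rewrite subr_eq0 !ffunE.
  have fI : injective (fun t => (val x t).1).
    by apply: (can_inj (g := fun u => (val x u).1)) => t'; rewrite diagramK.
  rewrite -(inj_eq fI t u) -(inj_eq fI t v) -/v.
  by rewrite /v diagramK /= orbC.
have hw q : gauge_weight z (q + h) = gauge_weight z q * gauge_weight z h.
  rewrite -big_split; apply: eq_bigr => t _.
  by rewrite !ffunE expr_labelD // charge_root.
have hS : S = gauge_weight z h *: S.
  rewrite scaler_sumr {1}/S (reindex_inj (addIr h)); apply: eq_bigr => q _.
  by rewrite hw gaugeD hx scalerA mulrC.
have wh : gauge_weight z h = charge z u * charge z v.
  rewrite /gauge_weight (bigD1 u) // (bigD1 v) /=; last by rewrite diagram_neq.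
  rewrite big1 ?mulr1 => [|t /andP[tu tv]]; last first.
    by rewrite ffunE (negPf tu) (negPf tv).
  (* For [m = 1] the label [inZp 1] is 0, and [a] is 1. *)
  have e1 a : a ^+ m = 1 -> a ^+ (inZp 1 : label m) = a.
    by move=> am; rewrite /= expr_mod.
  by rewrite !ffunE !eqxx orbT !e1 // charge_root.
have wh1 : gauge_weight z h - 1 != 0.
  rewrite subr_eq0 wh; apply: contra cu => /eqP E; apply/eqP.
  by apply: (mulfI (charge_neq0 zm u)); rewrite E divff // (charge_neq0 zm).
suff -> : S = 0 by rewrite scaler0.
by apply: (scalerI wh1); rewrite scaler0 scalerBl scale1r -hS subrr.
Qed.

End Idempotent.

(** * Algebras modelled on the compatible diagrams *)

Definition corner_map (k : fieldType) (m' n : nat) (z : 'I_n -> k)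
    (delta : m'.+1.-tuple k) (C : based_algebra k)
    (h : basis C -> diagram m'.+1 n) (x : elt C) :
        elt (cyclotomic_brauer n delta) :=
  \sum_c x c *: corner_vec z delta (h c).

Lemma corner_map_is_linear k m' n z delta C h :
  linear (@corner_map k m' n z delta C h).
Proof.
move=> a x y; rewrite /corner_map scaler_sumr -big_split; apply: eq_bigr => c _.
by rewrite !ffunE scalerDl /= [in RHS]scalerA.
Qed.

HB.instance Definition _ (k : fieldType) (m' n : nat) (z : 'I_n -> k)
    (delta : m'.+1.-tuple k) (C : based_algebra k)
    (h : basis C -> diagram m'.+1 n) :=
  GRing.isLinear.Build k {ffun basis C -> k^o}
    {ffun basis (cyclotomic_brauer n delta) -> k^o} *:%R
    (@corner_map k m' n z delta C h) (@corner_map_is_linear k m' n z delta C h).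

Section Models.

Variables (k : fieldType) (m' n : nat).
Local Notation m := m'.+1.
Variables (z : 'I_n -> k) (zm : forall i, z i ^+ m = 1).
Variable delta : m.-tuple k.
Hypothesis m_unit : m%:R != 0 :> k.
Local Notation A := (cyclotomic_brauer n delta).
Implicit Types x y : diagram m n.

Definition same_shapeb x y := [forall u, (val x u).1 == (val y u).1].

(** The coordinate functional at the matching of [y]: dividing by the weight makes every term of a
    corner vector count equally. *)
Definition shape_coef (y : diagram m n) (v : {ffun diagram m n -> k^o}) : k :=
  \sum_(D | same_shapeb D y) (weight z D)^-1 * v D.

Lemma shape_coef_corner_vec y x :
  shape_coef y (corner_vec z delta x) = (same_shapeb x y)%:R.
Proof.
rewrite /shape_coef /corner_vec.
under eq_bigr => D _.
  rewrite ffunE sum_ffunE.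
  over.
set N := #|_|%:R.
transitivity (N^-1 * \sum_(q : {ffun node n -> label m}) (same_shapeb x y)%:R : k).
  rewrite mulr_sumr.
  transitivity (\sum_(D | same_shapeb D y) \sum_(q : {ffun node n -> label m})
     N^-1 * ((weight z D)^-1 * (weight z (gauge q x) * (D == gauge q x)%:R))).
    apply: eq_bigr => D _; rewrite -mulr_sumr -mulr_sumr mulrCA;
        congr (_ * (_ * _)).
    by apply: eq_bigr => q _; rewrite !ffunE.
  rewrite exchange_big; apply: eq_bigr => q _ /=.
  have sE : same_shapeb (gauge q x) y = same_shapeb x y.
    by apply: eq_forallb => u; rewrite gauge_shape.
  rewrite -mulr_sumr; congr (_ * _); rewrite -sE.
  have [sq|nsq] := boolP (same_shapeb (gauge q x) y).
    rewrite (bigD1 (gauge q x)) //= eqxx mulr1 mulVf ?weight_neq0 //.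
    rewrite big1 ?addr0 // => D /andP[_ ne_D].
    by rewrite (negPf ne_D) !mulr0.
  rewrite big1 // => D sD; have [E|_] := eqVneq D (gauge q x);
      last by rewrite !mulr0.
  by rewrite -E sD in nsq.
rewrite sumr_const -[_ *+ #|_|]mulr_natl mulrA [X in X * _]mulVf ?mul1r //.
exact: card_gauge_neq0.
Qed.

Lemma corner_map_coef (C : based_algebra k) (h : basis C -> diagram m n)
    (x : elt C) c :
  (forall c c', same_shapeb (h c) (h c') = (c == c')) ->
  shape_coef (h c) (corner_map z delta h x) = x c.
Proof.
move=> hE; transitivity (\sum_c' x c' * shape_coef (h c) (corner_vec z delta (h c'))).
  rewrite /shape_coef; under [RHS]eq_bigr => c' _ do rewrite mulr_sumr.
  rewrite exchange_big; apply: eq_bigr => D _ /=.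
  rewrite /corner_map sum_ffunE mulr_sumr; apply: eq_bigr => c' _.
  by rewrite ffunE mulrCA.
rewrite (bigD1 c) //= big1 => [|c' ne_c]; rewrite shape_coef_corner_vec hE.
  by rewrite eqxx mulr1 addr0.
by rewrite (negPf ne_c) mulr0.
Qed.

Lemma corner_map_basis (C : based_algebra k) (h : basis C -> diagram m n) c :
  corner_map z delta h (basis_vec k c) = corner_vec z delta (h c).
Proof.
rewrite /corner_map (bigD1 c) //= big1 => [|c' ne_c]; rewrite ffunE.
  by rewrite eqxx scale1r addr0.
by rewrite (negPf ne_c) scale0r.
Qed.

Variables (fold : 'I_n -> nat) (loop_param : nat -> k).
Hypothesis fold_charge :
  forall i j, z i = z j \/ z i = (z j)^-1 -> fold i = fold j.
(** Restricted to leftmost nodes of loops because nodes of inverse types share their fold but may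
    have different loop values. *)
Hypothesis loop_paramE : forall x y j, compatible z x -> compatible z y ->
  loop_at x y j -> loop_value z delta j = loop_param (fold j).

Definition node_fold (u : node n) := match u with inl i => fold i | inr i => fold i end.

Lemma compatible_fold x u : compatible z x -> node_fold (val x u).1 = node_fold u.
Proof.
move=> /compatibleP/(_ u); case: u => i; case: (fst _) => j /= E;
    apply: fold_charge.
- by right.
- by left; apply: invr_inj.
- by left; rewrite E invrK.
- by right; apply: invr_inj; rewrite E.
Qed.

(* C is the algebra of the restrictions of the compatible diagrams to the
   nodes whose fold satisfies Q. *)
Definition models (C : based_algebra k) (Q : pred nat) : Prop :=
  exists g : diagram m n -> basis C,
  [/\ forall x y, compatible z x -> compatible z y ->
        (g x = g y <->
         forall u, Q (node_fold u) -> (val x u).1 = (val y u).1),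
      forall c, exists2 x, compatible z x & g x = c,
      forall x y, compatible z x -> compatible z y ->
        sc_mul (g x) (g y) =
        (\prod_(j | loop_at x y j && Q (fold j)) loop_param (fold j))
          *: basis_vec k (g (concat x y))
    & sc_one C = basis_vec k (g (id_diagram m n))].

(** As [Q] holds at every node, basis elements of [C] amount to matchings of compatible diagrams;
    each is sent to the corner vector of its matching. *)
Lemma corner_isomorphic_models (C : based_algebra k) (Q : pred nat) :
  models C Q -> (forall j, Q (fold j)) ->
  corner_isomorphic (twist_idem z delta [set: 'I_n]) C.
Proof.
case=> g [gP g_surj gM g1] Qall.
have Qn u : Q (node_fold u) by case: u => i; apply: Qall.
have [h ch gh] := fin_all_exists2 g_surj.
have hE c c' : same_shapeb (h c) (h c') = (c == c').
  apply/forallP/eqP => [H|-> u //].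
  rewrite -(gh c) -(gh c'); apply/(gP _ _ (ch c) (ch c')) => u _; exact/eqP.
have gh_shape x : compatible z x -> corner_vec z delta (h (g x)) = corner_vec z delta x.
  move=> cx; apply: corner_vec_shape => u.
  by apply: (proj1 (gP _ _ (ch (g x)) cx)) => //; rewrite gh.
exists (corner_map z delta h); split.
- by move=> x y E; apply/ffunP => c; rewrite
    -(corner_map_coef x c hE) E corner_map_coef.
- move=> v; split=> [[x ->]|[x <-]].
    (* Incompatible diagrams are killed by the corner; the others give corner vectors divided by
       their weights. *)
    rewrite [x]sum_basis_vec corner_sum.
    exists (\sum_(D | compatible z D) (x D * (weight z D)^-1) *:
              basis_vec k (g D) : elt C).
    rewrite linear_sum big_mkcond; apply: eq_bigr => D _.
    have [cD|ncD] := boolP (compatible z D).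
      rewrite linearZ corner_basis_compatible // scalerA; congr (_ *: _).
      by rewrite /= corner_map_basis gh_shape.
    by rewrite corner_basis_incompatible // scaler0.
  exists (\sum_c (x c * weight z (h c)) *: basis_vec k (h c)).
  rewrite corner_sum; apply: eq_bigr => c _.
  rewrite corner_basis_compatible // [RHS]scalerA; congr (_ *: _).
  by apply/esym/mulfK; apply: weight_neq0.
- move=> x y.
  rewrite [in RHS]/corner_map amul_suml.
  transitivity (\sum_a \sum_b (x a * y b) *: corner_map z delta h (sc_mul a b)).
    rewrite /amul linear_sum; apply: eq_bigr => a _; rewrite linear_sum.
    by apply: eq_bigr => b _; rewrite linearZ.
  apply: eq_bigr => a _; rewrite amul_sumr; apply: eq_bigr => b _.
  rewrite amulZl amulZr scalerA; congr (_ *: _).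
  rewrite amul_corner_vec // -{1}(gh a) -{1}(gh b) gM // linearZ.
  rewrite /= corner_map_basis gh_shape ?compatible_concat //; congr (_ *: _).
  by apply: eq_big => [j|j /andP[lj _]];
      rewrite ?Qall ?andbT // (loop_paramE (ch a) (ch b)).
- rewrite /aone g1 /= corner_map_basis gh_shape ?compatible_id //.
  exact: corner_vec_id.
Qed.

End Models.

(** * Models of tensor products and of single factors *)

Section Products.

Variables (k : fieldType) (m' n : nat).
Local Notation m := m'.+1.
Variables (z : 'I_n -> k).
Variables (fold : 'I_n -> nat) (loop_param : nat -> k).
Hypothesis fold_charge :
  forall i j, z i = z j \/ z i = (z j)^-1 -> fold i = fold j.
Local Notation node_fold := (node_fold fold).
Local Notation models := (@models k m' n z fold loop_param).
Implicit Types x y : diagram m n.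

Lemma models_eq (C : based_algebra k) (Q Q' : pred nat) :
  Q =1 Q' -> models C Q -> models C Q'.
Proof.
move=> QQ' [g [g_inj g_surj gM g1]]; exists g; split=> // x y cx cy.
  by split=> [/(g_inj _ _ cx cy) H u|H]; [|apply/(g_inj _ _ cx cy) => u];
    [rewrite -QQ'; apply: H | rewrite QQ'; apply: H].
by rewrite gM //; congr (_ *: _); apply: eq_bigl => j; rewrite QQ'.
Qed.

Lemma models_ground : models (ground_algebra k) pred0.
Proof.
exists (fun=> tt); split=> [x y _ _|[]|x y _ _|]; first by [].
- by exists (id_diagram m n) => //; apply: compatible_id.
- rewrite big_pred0 => [|j]; last by rewrite andbF.
  by rewrite scale1r; apply/ffunP => -[]; rewrite !ffunE.
- by apply/ffunP => -[]; rewrite !ffunE.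
Qed.

Section Mix.

Variables (Q : pred nat) (x y : diagram m n).
Hypotheses (cx : compatible z x) (cy : compatible z y).

(** A diagram because compatible strands preserve the fold, so none leads from the part taken from
    [x] to the part taken from [y]. *)
Definition mix_fun : {ffun node n -> node n * label m} :=
  [ffun u => if Q (node_fold u) then val x u else val y u].

Lemma mix_is_diagram : is_diagram mix_fun.
Proof.
apply/forallP => u; rewrite !ffunE; case: ifP => Qu.
  by rewrite (compatible_fold fold_charge) // Qu diagram_neq diagramK eqxx.
by rewrite (compatible_fold fold_charge) // Qu diagram_neq diagramK eqxx.
Qed.

Definition mix : diagram m n := exist _ mix_fun mix_is_diagram.

Lemma compatible_mix : compatible z mix.
Proof.
apply/compatibleP => u; rewrite ffunE; case: ifP => _.
  by apply/compatibleP: u.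
by apply/compatibleP: u.
Qed.

End Mix.

(** Disjointness of [Q] and [Q'] allows two restrictions to be prescribed at once, by [mix], and
    makes each loop count in at most one factor. *)
Lemma models_tensor (C C' : based_algebra k) (Q Q' : pred nat) :
  models C Q -> models C' Q' -> (forall r, Q r -> ~~ Q' r) ->
  models (tensor_algebra C C') (predU Q Q').
Proof.
case=> g [g_inj g_surj gM g1] [g' [g_inj' g_surj' gM' g1']] QQ'.
exists (fun x => (g x, g' x)); split.
- move=> x y cx cy; split=> [[/(g_inj _ _ cx cy) H /(g_inj' _ _ cx cy) H'] u|H].
    by case/orP; [apply: H | apply: H'].
  by congr pair; [apply/(g_inj _ _ cx cy) | apply/(g_inj' _ _ cx cy)] => u Qu;
    apply: H; rewrite /= Qu ?orbT.
- case=> c c'; have [x cx gx] := g_surj c; have [x' cx' gx'] := g_surj' c'.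
  exists (mix Q cx cx'); first exact: compatible_mix.
  rewrite -gx -gx'; congr pair.
    apply/(g_inj _ _ (compatible_mix _ _ _) cx) => u Qu.
    by rewrite ffunE Qu.
  apply/(g_inj' _ _ (compatible_mix _ _ _) cx') => u Qu.
  by rewrite ffunE ifN //; apply: contraL Qu; apply: QQ'.
- move=> x y cx cy; apply/ffunP => -[c c']; rewrite ffunE /= gM // gM' // !ffunE.
  rewrite xpair_eqE -mulnb natrM [LHS]mulrACA; congr (_ * _).
  rewrite [RHS](bigID (fun j => Q (fold j))); congr (_ * _).
    by apply: eq_bigl => j; rewrite -andbA; case: (Q _); rewrite ?andbT ?andbF.
  apply: eq_bigl => j; rewrite -andbA /=; have := QQ' (fold j).
  by case: (Q _) => [/(_ isT)/negPf ->|_]; rewrite ?andbF ?andbT.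
- by apply/ffunP => -[c c']; rewrite !ffunE /= g1 g1' !ffunE xpair_eqE -mulnb natrM.
Qed.

Lemma models_big (s : seq nat) (C : nat -> based_algebra k) : uniq s ->
  (forall r, r \in s -> models (C r) (pred1 r)) ->
  models (\big[@tensor_algebra k/ground_algebra k]_(r <- s) C r) (mem s).
Proof.
elim: s => [_ _|r s IH /= /andP[rs us] H].
  by rewrite big_nil; apply: models_eq models_ground.
rewrite big_cons; apply: (@models_eq _ (predU (pred1 r) (mem s))).
  by move=> r' /=; rewrite inE.
apply: models_tensor; first by apply: H; rewrite mem_head.
  by apply: IH => // r' r's; apply: H; rewrite inE r's orbT.
by move=> r' /eqP ->.
Qed.

Section Factor.

Variables (a : nat) (f : 'I_a -> 'I_n) (r : nat).
Hypothesis f_mono : forall i j, (f i <= f j)%N = (i <= j)%N.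
Hypothesis f_img : forall j, fold j = r <-> exists i, f i = j.

Let f_inj : injective f.
Proof. by move=> i j E; apply/val_inj/anti_leq; rewrite -!f_mono E leqnn. Qed.

Let fn_inj : injective (node_map f) := node_map_inj f_inj.

Lemma node_map_img u : node_fold u = r <-> exists v, node_map f v = u.
Proof.
case: u => j; rewrite /= f_img; split=> [[i <-]|[[] i //= [<-]]];
  by [exists (inl i) | exists (inr i) | exists i].
Qed.

(** The defaults, here [u] and in [restrict] the identity, are met only if [x] is incompatible. *)
Definition restrict_fun x : {ffun node a -> node a * label 1} :=
  [ffun u => (odflt u [pick v | node_map f v == (val x (node_map f u)).1], 0)].

Definition restrict x : diagram 1 a := insubd (id_diagram 1 a) (restrict_fun x).

Lemma restrict_embeds x : compatible z x -> embeds f x (restrict x).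
Proof.
move=> cx; have mapE u : node_map f (restrict_fun x u).1 = (val x (node_map f u)).1.
  rewrite ffunE /=; case: pickP => [v /eqP //|no].
  have /node_map_img[v E] : node_fold (val x (node_map f u)).1 = r.
    by rewrite (compatible_fold fold_charge) //; apply/node_map_img; exists u.
  by have := no v; rewrite E eqxx.
suff diag : is_diagram (restrict_fun x) by move=> u; rewrite insubdK.
apply/forallP => u; rewrite -(inj_eq fn_inj) mapE diagram_neq /=.
rewrite [X in X == _]surjective_pairing xpair_eqE -(inj_eq fn_inj).
by rewrite !mapE diagramK eqxx !ord1 eqxx.
Qed.

Lemma embeds_uniq x (x1 x2 : diagram 1 a) :
  embeds f x x1 -> embeds f x x2 -> x1 = x2.
Proof.
move=> e1 e2; apply: diagram_eqP => u; split; last by rewrite !ord1.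
by apply: fn_inj; rewrite -e1 -e2.
Qed.

Lemma restrict_eq x y : compatible z x -> compatible z y ->
  (restrict x = restrict y <->
   forall u, node_fold u = r -> (val x u).1 = (val y u).1).
Proof.
move=> cx cy; split=> [E u /node_map_img[v <-]|H].
  by rewrite (restrict_embeds cx) (restrict_embeds cy) E.
apply: (@embeds_uniq y); last exact: restrict_embeds.
move=> u; rewrite -(restrict_embeds cx) H //; apply/node_map_img; by exists u.
Qed.

Lemma restrict_concat x y : compatible z x -> compatible z y ->
  restrict (concat x y) = concat (restrict x) (restrict y).
Proof.
move=> cx cy; apply: (@embeds_uniq (concat x y)).
  exact/restrict_embeds/compatible_concat.
by apply: concat_embed; apply: restrict_embeds.
Qed.

Lemma restrict_id : restrict (id_diagram m n) = id_diagram 1 a.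
Proof.
apply: (@embeds_uniq (id_diagram m n)); first exact/restrict_embeds/compatible_id.
by case=> i; rewrite !ffunE.
Qed.

Lemma loop_scalar_restrict x y : compatible z x -> compatible z y ->
  loop_scalar [tuple loop_param r] (restrict x) (restrict y) =
  \prod_(j | loop_at x y j && (fold j == r)) loop_param (fold j).
Proof.
move=> cx cy; have [ex ey] := (restrict_embeds cx, restrict_embeds cy).
transitivity (\prod_(i in [set i | loop_at (restrict x) (restrict y) i])
    loop_param (fold (f i))).
  apply: eq_big => [i|i _]; first by rewrite inE.
  rewrite ord1 /=; congr loop_param; apply/esym/f_img; by exists i.
rewrite -(big_imset (fun j => loop_param (fold j)) (in2W f_inj)) /=.
apply: eq_bigl => j; apply/imsetP/andP => [[i]|[lj /eqP/f_img[i fi]]].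
  rewrite inE -(loop_at_embed ex ey) // => li ->; split=> //.
  by apply/eqP/f_img; exists i.
by exists i => //; rewrite inE -(loop_at_embed ex ey) // fi.
Qed.

Section Extend.

Variable x' : diagram 1 a.

(** The strands outside the image of [f] are those of the identity, which is compatible with any
    charges. *)
Definition extend_fun : {ffun node n -> node n * label m} :=
  [ffun u => (if [pick v | node_map f v == u] is Some v then node_map f (val x' v).1
              else (val (id_diagram m n) u).1, 0)].

Lemma extend_funE v : extend_fun (node_map f v) = (node_map f (val x' v).1, 0).
Proof.
rewrite ffunE; case: pickP => [v' /eqP/fn_inj -> //|/(_ v)].
by rewrite eqxx.
Qed.

Lemma extend_fun_out u : node_fold u <> r ->
  extend_fun u = ((val (id_diagram m n) u).1, 0).
Proof.
move=> ur; rewrite ffunE; case: pickP => // v /eqP vu.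
by case: ur; apply/node_map_img; exists v.
Qed.

Lemma extend_is_diagram : is_diagram extend_fun.
Proof.
apply/forallP => u; have [/eqP/node_map_img[v <-]|/eqP ur] :=
    boolP (node_fold u == r).
  rewrite !extend_funE /= ?extend_funE (inj_eq fn_inj) diagram_neq diagramK.
  by rewrite oppr0 eqxx.
have ur' : node_fold (val (id_diagram m n) u).1 <> r.
  by rewrite (compatible_fold fold_charge) //; apply: compatible_id.
rewrite (extend_fun_out ur); cbn [fst snd].
by rewrite (extend_fun_out ur') diagram_neq diagramK oppr0 eqxx.
Qed.

Definition extend : diagram m n := exist _ extend_fun extend_is_diagram.

Hypothesis cx' : compatible (z \o f) (m' := 0) x'.

Lemma charge_node_map u : charge (z \o f) u = charge z (node_map f u).
Proof. by case: u. Qed.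

Lemma compatible_extend : compatible z extend.
Proof.
apply/compatibleP => u; have [/eqP/node_map_img[v <-]|/eqP ur] :=
    boolP (node_fold u == r).
  by rewrite extend_funE /= -!charge_node_map; apply/compatibleP: v.
by rewrite extend_fun_out //; apply/compatibleP/compatible_id.
Qed.

Lemma restrict_extend : restrict extend = x'.
Proof.
apply: (@embeds_uniq extend); first exact/restrict_embeds/compatible_extend.
by move=> v; rewrite extend_funE.
Qed.

End Extend.

Lemma compatible_restrict x : compatible z x ->
    compatible (z \o f) (m' := 0) (restrict x).
Proof.
move=> cx; apply/compatibleP => u; rewrite !charge_node_map -restrict_embeds //.
by apply/compatibleP: (node_map f u).
Qed.

(** Serves both kinds of factor: [b] lists the compatible diagrams on the nodes of fold [r], and the
    structure constants need only follow concatenation, with [loop_param r] for each closed loop. *)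
Lemma models_factor (C : based_algebra k) (b : basis C -> diagram 1 a) :
  injective b ->
  (forall x' : diagram 1 a, compatible (z \o f) (m' :=
      0) x' <-> exists c, b c = x') ->
  (forall c c' c'', b c'' = concat (b c) (b c') ->
     sc_mul c c' = loop_scalar [tuple loop_param r] (b c) (b c') *:
         basis_vec k c'') ->
  (forall c, b c = id_diagram 1 a -> sc_one C = basis_vec k c) ->
  models C (pred1 r).
Proof.
move=> b_inj b_img bM b1.
have [c0 _] : exists c, b c = id_diagram 1 a by apply/b_img/compatible_id.
pose g x := odflt c0 [pick c | b c == restrict x].
have bg x : compatible z x -> b (g x) = restrict x.
  move=> /compatible_restrict/b_img[c bc]; rewrite /g.
  by case: pickP => [c' /eqP|/(_ c)] //; rewrite bc eqxx.
exists g; split.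
- move=> x y cx cy; have R := restrict_eq cx cy.
  split=> [E u /eqP ur|H]; first by apply: (proj1 R) => //; rewrite -!bg // E.
  by apply: b_inj; rewrite !bg //; apply: (proj2 R) => u ur; apply: H; apply/eqP.
- move=> c; have cb : compatible (z \o f) (m' := 0) (b c) by apply/b_img; exists c.
  exists (extend (b c)); first exact: compatible_extend.
  by apply: b_inj; rewrite bg ?restrict_extend //; apply: compatible_extend.
- move=> x y cx cy; rewrite (bM _ _ (g (concat x y))).
    by rewrite !bg // loop_scalar_restrict.
  by rewrite !bg ?restrict_concat //; apply: compatible_concat.
- by apply: b1; rewrite bg ?restrict_id //; apply: compatible_id.
Qed.

End Factor.

End Products.

(** * Blocks of the composition *)

Section Blocks.

Variables (m' n : nat).
Local Notation m := m'.+1.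
Variable omega : m.-tuple nat.
Hypothesis omega_comp : is_composition n omega.

Definition offset (r : nat) : nat := (\sum_(j < r) nth 0%N omega j)%N.

Lemma offsetS r : offset r.+1 = (offset r + nth 0%N omega r)%N.
Proof. by rewrite /offset big_ord_recr. Qed.

Lemma offset_mono r s : (r <= s)%N -> (offset r <= offset s)%N.
Proof.
elim: s => [|s IH]; first by rewrite leqn0 => /eqP ->.
rewrite leq_eqVlt => /orP[/eqP -> //|/IH le_rs].
by rewrite offsetS (leq_trans le_rs) // leq_addr.
Qed.

Lemma offset_last : offset m = n.
Proof. exact: omega_comp. Qed.

Let block_ex (j : 'I_n) : exists r, (j < offset r.+1)%N.
Proof. by exists m'; rewrite offset_last. Qed.

(** The type of the node [j]; minimality excludes empty blocks. *)
Definition block (j : 'I_n) : nat := ex_minn (block_ex j).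

Lemma in_blockE r (j : 'I_n) : in_block omega r j = (r == block j).
Proof.
rewrite /in_block -/(offset r) -/(offset r.+1) /block.
case: ex_minnP => s lt_js smin; apply/andP/eqP => [[le_rj lt_jr]|->].
  apply/anti_leq; rewrite [(s <= r)%N]smin // andbT leqNgt; apply/negP => lt_sr.
  by have := leq_trans lt_js (offset_mono lt_sr); rewrite ltnNge le_rj.
split=> //; case: s {lt_js} smin => [|s] smin; first by rewrite /offset big_ord0.
by rewrite leqNgt; apply/negP => /smin; rewrite ltnn.
Qed.

Lemma block_lt j : (block j < m)%N.
Proof. by rewrite /block; case: ex_minnP => s _; apply; rewrite offset_last. Qed.

Lemma block_mono (j j' : 'I_n) : (j <= j')%N -> (block j <= block j')%N.
Proof.
move=> le_jj'; have := eqxx (block j'); rewrite -in_blockE => /andP[_ lt_j'].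
rewrite {1}/block; case: ex_minnP => s _; apply.
exact: leq_ltn_trans lt_j'.
Qed.

(** The representative, at most m/2, of the type up to sign modulo [m]. *)
Definition block_fold (j : 'I_n) : nat := minn (block j) (m - block j).

Lemma offset_lt r i : (r < m)%N -> (i < nth 0%N omega r)%N -> (offset r + i < n)%N.
Proof.
move=> lt_rm lt_i; rewrite -offset_last.
by apply: leq_trans (offset_mono lt_rm); rewrite offsetS ltn_add2l.
Qed.

Section BlockMap.
Variables (r : nat) (r_lt : (r < m)%N).

Definition block_map (i : 'I_(nth 0%N omega r)) : 'I_n :=
  Ordinal (offset_lt r_lt (ltn_ord i)).

Lemma block_map_mono i j : (block_map i <= block_map j)%N = (i <= j)%N.
Proof. by rewrite leq_add2l. Qed.

Lemma block_mapP j : block j = r <-> exists i, block_map i = j.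
Proof.
split=> [/esym/eqP|[i <-]].
  rewrite -in_blockE => /andP[le_j lt_j].
  rewrite -/(offset r) in le_j; rewrite -/(offset r.+1) offsetS in lt_j.
  have lt_i : (j - offset r < nth 0%N omega r)%N by lia.
  by exists (Ordinal lt_i); apply: val_inj; rewrite /= subnKC.
apply/esym/eqP; rewrite -in_blockE /in_block -/(offset r) -/(offset r.+1) offsetS /=.
by rewrite leq_addr ltn_add2l ltn_ord.
Qed.

Lemma block_map_block i : block (block_map i) = r.
Proof. by apply/block_mapP; exists i. Qed.

End BlockMap.

Section WalledMap.

Variables (r : nat) (r_lt : (r < m - r)%N) (r_gt0 : (0 < r)%N).
Local Notation a := (nth 0%N omega r).
Local Notation b := (nth 0%N omega (m - r)).

Let r_lt_m : (r < m)%N.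
Proof. lia. Qed.

Let mr_lt_m : (m - r < m)%N.
Proof. lia. Qed.

(** As r < m - r, the block of type [r] lies to the left of that of type [m - r]; with the wall
    between them the map is monotone. *)
Definition walled_map (i : 'I_(a + b)) : 'I_n :=
  match split i with
  | inl i => block_map r_lt_m i
  | inr i => block_map mr_lt_m i
  end.

Lemma walled_map_mono i j : (walled_map i <= walled_map j)%N = (i <= j)%N.
Proof.
have le_off : (offset r + a <= offset (m - r))%N.
  by rewrite -offsetS; apply: offset_mono.
rewrite /walled_map; case: (splitP i) => i' ->; case: (splitP j) => j' -> /=;
  have := ltn_ord i'; have := ltn_ord j'; lia.
Qed.

Lemma walled_map_block i :
  block (walled_map i) = if (i < a)%N then r else (m - r)%N.
Proof.
by rewrite /walled_map; case: (splitP i) => i' _; rewrite block_map_block.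
Qed.

Lemma walled_mapP j : block_fold j = r <-> exists i, walled_map i = j.
Proof.
split=> [E|[i <-]]; last first.
  by rewrite /block_fold walled_map_block; case: ifP; lia.
have [/block_mapP|/block_mapP] : block j = r \/ block j = (m - r)%N.
- by move: E; rewrite /block_fold; have := block_lt j; lia.
- move=> /(_ r_lt_m)[i <-]; exists (lshift b i).
  by rewrite /walled_map (unsplitK (inl i)).
- move=> /(_ mr_lt_m)[i <-]; exists (rshift a i).
  by rewrite /walled_map (unsplitK (inr i)).
Qed.

End WalledMap.

Variables (k : fieldType) (xi : k) (xi_prim : m.-primitive_root xi).
Variable delta : m.-tuple k.

Definition block_root (j : 'I_n) : k := xi ^+ block j.

Lemma block_root_expr j : block_root j ^+ m = 1.
Proof. by rewrite /block_root exprAC (prim_expr_order xi_prim) expr1n. Qed.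

Let xi_neq0 i : xi ^+ i != 0.
Proof.
apply: expf_neq0; apply: contra_eq_neq (prim_expr_order xi_prim) => ->.
by rewrite exprS mul0r eq_sym oner_neq0.
Qed.

(** The sum of two types is here a multiple of [m], and it is below 2m. *)
Lemma block_root_inv i j : block_root i = (block_root j)^-1 ->
  (block i + block j = 0 \/ block i + block j = m)%N.
Proof.
move=> E; have : xi ^+ (block i + block j) == 1.
  by rewrite exprD -/(block_root i) E mulVf ?xi_neq0.
rewrite -(prim_order_dvd xi_prim) => /dvdnP[[|[|c]]]; have := block_lt i;
  have := block_lt j; lia.
Qed.

Lemma block_fold_charge i j :
  block_root i = block_root j \/ block_root i = (block_root j)^-1 ->
  block_fold i = block_fold j.
Proof.
case=> [/eqP|/block_root_inv]; last first.
  by rewrite /block_fold; have := block_lt i; have := block_lt j; lia.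
rewrite (eq_prim_root_expr xi_prim) !modn_small ?block_lt // => /eqP E.
by rewrite /block_fold E.
Qed.

(* A loop passes through two nodes of opposite types, and the blocks are
   arranged by increasing type, so the leftmost node has type at most m/2. *)
Lemma loop_block_fold (x y : diagram m n) j : compatible block_root y ->
  loop_at x y j -> block_fold j = block j.
Proof.
move=> /compatibleP/(_ (inl j)) cy /loop_atP/(_ 1%N).
rewrite /= /walk /dart_end /dart_strand /=.
case: (fst (val y (inl j))) cy => j' /= cy [] // _ /block_mono.
by have := block_root_inv cy; rewrite /block_fold; have := block_lt j; lia.
Qed.

Lemma loop_value_block (x y : diagram m n) j : compatible block_root x ->
  compatible block_root y -> loop_at x y j ->
  loop_value block_root delta j = delta_bar delta xi (block_fold j).
Proof.
move=> _ cy lj; rewrite (loop_block_fold cy lj) /loop_value /delta_bar.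
by congr (_ * _); apply: eq_bigr => c _; rewrite mulnC exprM.
Qed.

Lemma pi_idem_twist_idem (m_unit : m%:R != 0 :> k) :
  pi_idem n delta xi omega = twist_idem block_root delta [set: 'I_n].
Proof.
rewrite /pi_idem (big_twist_idem block_root_expr m_unit _
  (S := fun r : 'I_m => \bigcup_(i < n | in_block omega r i) [set i])); last first.
  move=> r _; apply: (big_twist_idem block_root_expr m_unit) => i.
  rewrite in_blockE => /eqP ri; apply: Tidem_twist_idem.
    exact: block_root_expr.
  by rewrite ri.
congr twist_idem; apply/setP => i; rewrite inE; apply/bigcupP.
exists (Ordinal (block_lt i)) => //; apply/bigcupP; exists i; rewrite ?inE //.
by rewrite in_blockE.
Qed.

Local Notation models :=
  (@models k m' n block_root block_fold (delta_bar delta xi)).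

(** The common charge xi^r is its own inverse, so every diagram on the block is compatible. *)
Lemma models_brauer r : (r < m)%N -> (r = m - r \/ r = 0)%N ->
  models (brauer (nth 0%N omega r) (delta_bar delta xi r)) (pred1 r).
Proof.
move=> lt_rm self_r.
have img j : block_fold j = r <-> exists i, block_map lt_rm i = j.
  rewrite -block_mapP /block_fold; have := block_lt j; lia.
apply: (models_factor (C := brauer _ _) (b := id) m' block_fold_charge
  (block_map_mono lt_rm) img) => //.
- move=> x'; split=> [_|_]; first by exists x'.
  have inv : (xi ^+ r)^-1 = xi ^+ r.
    case: self_r => [rE|->]; last by rewrite invr1.
    apply: (mulfI (xi_neq0 r)); rewrite divff ?xi_neq0 // -exprD.
    have -> : (r + r = m)%N by lia.
    by rewrite (prim_expr_order xi_prim).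
  have rootE u : charge (block_root \o block_map lt_rm) u = xi ^+ r.
    by case: u => i; rewrite /= /block_root block_map_block ?inv.
  by apply/compatibleP => u; rewrite !rootE inv.
- by move=> c c' c'' /= ->.
- by move=> c ->.
Qed.

(** The charge depends on whether exactly one of northern and left of the wall holds; its two values
    are inverse and distinct, so compatibility is the wall condition in the form of [walledP]. *)
Lemma models_walled r : (0 < r)%N -> (r < m - r)%N ->
  models (walled_brauer (nth 0%N omega r) (nth 0%N omega (m - r))
            (delta_bar delta xi r)) (pred1 r).
Proof.
move=> r_gt0 lt_r.
apply: (models_factor (C := walled_brauer _ _ _) (b := val) m' block_fold_charge
  (walled_map_mono lt_r r_gt0) (walled_mapP lt_r r_gt0)).
- exact: val_inj.
- have rootE u : charge (block_root \o walled_map lt_r r_gt0) u =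
      if northern u (+) left_of_wall (nth 0%N omega r) u then (xi ^+ r)^-1 else xi ^+ r.
    have mr : xi ^+ (m - r) = (xi ^+ r)^-1.
      apply: (mulfI (xi_neq0 r)); rewrite divff ?xi_neq0 // -exprD subnKC; last lia.
      by rewrite (prim_expr_order xi_prim).
    case: u => i; rewrite /= /block_root walled_map_block /left_of_wall /=;
      by case: ifP => _; rewrite ?mr ?invrK.
  (* Here 0 < 2r < m, so the power of xi of exponent 2r is not 1. *)
  have ne : (xi ^+ r)^-1 != xi ^+ r.
    apply/negP => /eqP E; have : xi ^+ (r + r) == 1 by rewrite exprD -{1}E mulVf ?xi_neq0.
    rewrite -(prim_order_dvd xi_prim) => /dvdnP[[|c]]; lia.
  move=> x'; transitivity (walled x' : Prop).
    split=> [/compatibleP H|/walledP H]; [apply/walledP|apply/compatibleP] => u;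
      have := H u; rewrite ?rootE.
      case: (northern _ (+) _); case: (northern u (+) _) => // /eqP; rewrite ?invrK.
        by rewrite (negPf ne).
      by rewrite eq_sym (negPf ne).
    by move=> ->; case: (northern u (+) _); rewrite ?invrK.
  split=> [w|[c <-]]; last exact: valP.
  by exists (exist _ x' w).
- move=> c c' c'' E; apply/ffunP => d; rewrite !ffunE; congr (_ * _).
  by rewrite -E (inj_eq val_inj).
- move=> c E; apply/ffunP => d; rewrite !ffunE -E.
  by rewrite (inj_eq val_inj).
Qed.

End Blocks.

Theorem theorem5p4p2 (k : closedFieldType) (p m n : nat) (xi : k)
    (delta : m.-tuple k) (omega : m.-tuple nat)
    (char_k : has_characteristic k p)
    (m_gt0 : (0 < m)%N) (m_unit : m%:R != 0 :> k)
    (xi_prim : m.-primitive_root xi)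
    (n_gt0 : (0 < n)%N)
    (p_large : p = 0%N \/ (n < p)%N)
    (delta_neq0 : ~~ odd n -> exists i : 'I_m, tnth delta i != 0)
    (omega_comp : is_composition n omega) :
  (odd m ->
     corner_isomorphic (@pi_idem k m n delta xi omega)
       (tensor_algebra
          (brauer (nth 0%N omega 0) (delta_bar delta xi 0))
          (\big[@tensor_algebra k/ground_algebra k]_(1 <= r < (m./2).+1)
              walled_brauer (nth 0%N omega r) (nth 0%N omega (m - r)) (delta_bar delta xi r))))
  /\
  (~~ odd m ->
     corner_isomorphic (@pi_idem k m n delta xi omega)
       (tensor_algebra
          (tensor_algebra
             (brauer (nth 0%N omega 0) (delta_bar delta xi 0))
             (\big[@tensor_algebra k/ground_algebra k]_(1 <= r < m./2)
                 walled_brauer (nth 0%N omega r) (nth 0%N omega (m - r)) (delta_bar delta xi r)))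
          (brauer (nth 0%N omega (m./2)) (delta_bar delta xi (m./2))))).
Proof.
destruct m as [|m']; first by [].
have loopE := @loop_value_block _ _ _ omega_comp _ _ xi_prim delta.
have fold_charge := @block_fold_charge _ _ _ omega_comp _ _ xi_prim.
rewrite (pi_idem_twist_idem omega_comp xi_prim delta m_unit).
have block_lt := block_lt omega_comp.
have m0 := models_brauer omega_comp xi_prim delta (r := 0%N) isT (or_intror erefl).
split=> m_odd; apply: (corner_isomorphic_models
    (block_root_expr omega_comp xi_prim) m_unit loopE).
- apply: (models_tensor fold_charge m0).
    apply: (models_big fold_charge); first exact: iota_uniq.
    by move=> r; rewrite mem_index_iota => r_bd; apply: models_walled => //; lia.
  by move=> r /eqP ->; rewrite /= mem_index_iota.
(* Every fold is at most m/2, so the factors account for all nodes. *)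
- move=> j; rewrite /= mem_index_iota /block_fold; have := block_lt j; lia.
- have m_half : (m'.+1./2 = m'.+1 - m'.+1./2)%N by lia.
  apply: (models_tensor fold_charge).
  + apply: (models_tensor fold_charge m0).
      apply: (models_big fold_charge); first exact: iota_uniq.
      by move=> r; rewrite mem_index_iota => r_bd; apply: models_walled => //; lia.
    by move=> r /eqP ->; rewrite /= mem_index_iota.
  + by apply: models_brauer => //; [lia | left].
  + by move=> r /=; rewrite mem_index_iota; lia.
- move=> j; rewrite /= mem_index_iota /block_fold; have := block_lt j; lia.
Qed.
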